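(* For the quantum group $\mathfrak{D}$ at $\mathbb{S}_3$ attached to the 12-dimensional Fomin–Kirillov algebra, let $\mathsf{t}_{\lambda,\mu}=\Bbbk(\lambda|e\rangle^1+\mu|e\rangle^3)\subset\mathsf{M}(\sigma,-)$ and $\mathsf{T}_{\lambda,\mu}=\mathsf{t}_{\lambda,\mu}\oplus\mathsf{S}(\sigma,-)$ for $\lambda,\mu\in\Bbbk$ with $(\lambda,\mu)\neq(0,0)$, where $$|e\rangle^1=x_{(12)}|12\rangle+x_{(23)}|23\rangle+x_{(13)}|13\rangle,$$ $$|e\rangle^3=x_{(13)}x_{(12)}x_{(23)}|12\rangle-x_{(12)}x_{(13)}x_{(12)}|23\rangle+x_{(12)}x_{(13)}x_{(23)}|13\rangle.$$ Then $\mathfrak{D}\,\mathsf{t}_{\lambda,\mu}=\mathsf{T}_{\lambda,\mu}$. In particular, $\mathsf{T}_{1,0}$ is a highest-weight submodule of weight $(e,+)$.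
   Context: $\Bbbk$ is an algebraically closed field of characteristic zero; $\sigma=(12)$, $\tau=(123)$ in $\mathbb{S}_3$, permutations composed right to left. $V=\Bbbk\{x_{(12)},x_{(23)},x_{(13)}\}$ is the Yetter–Drinfeld module over $\Bbbk\mathbb{S}_3$ with $g\cdot x_{(ij)}=\mathrm{sgn}(g)x_{g(ij)g^{-1}}$ and coaction $x_{(ij)}\mapsto(ij)\otimes x_{(ij)}$. Its Nichols algebra $\mathfrak{B}(V)$ is the 12-dimensional Fomin–Kirillov algebra (top degree 4). $\mathfrak{D}$ is the Drinfeld double of the bosonization $\mathfrak{B}(V)\#\Bbbk\mathbb{S}_3$. Explicitly, $\mathfrak{D}$ is the algebra generated by $x_{(ij)}$, $y_{(ij)}$ (transpositions $(ij)$) and $g,\delta_g$ ($g\in\mathbb{S}_3$), where the $g$ multiply as in $\mathbb{S}_3$, the $\delta_g$ are orthogonal idempotents with sum $1$, and, for distinct $i,j,k$ and $g,h\in\mathbb{S}_3$: $x_{(ij)}^2=0$, $x_{(ij)}x_{(ik)}+x_{(jk)}x_{(ij)}+x_{(ik)}x_{(jk)}=0$; the same relations for the $y$'s; $\delta_hg=g\delta_{g^{-1}hg}$; $gx_{(ij)}=\mathrm{sgn}(g)x_{g(ij)g^{-1}}g$; $\delta_hx_{(ij)}=x_{(ij)}\delta_{(ij)h}$; $\delta_gy_{(ij)}=y_{(ij)}\delta_{(ij)g}$; $y_{(ij)}g=\mathrm{sgn}(g)\,g\,y_{g^{-1}(ij)g}$; $y_{(ij)}x_{(ij)}+x_{(ij)}y_{(ij)}=1+(ij)(\delta_{(ij)}-\delta_e)$;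 $y_{(ik)}x_{(ij)}+x_{(ij)}y_{(jk)}=(ij)(\delta_{(ik)}-\delta_{(ik)(ij)})$. The $g,\delta_g$ generate the Drinfeld double $\mathfrak{D}(\mathbb{S}_3)$ of $\Bbbk\mathbb{S}_3$; $\overline V=\Bbbk\{y_{(ij)}\}$ generates $\mathfrak{B}(\overline V)$; multiplication $\mathfrak{B}(V)\otimes\mathfrak{D}(\mathbb{S}_3)\otimes\mathfrak{B}(\overline V)\to\mathfrak{D}$ is a linear isomorphism. Simple $\mathfrak{D}(\mathbb{S}_3)$-modules relevant here (''degree $h$'' means $\delta_h$ acts as identity and other $\delta$'s by $0$): $M(e,+)=\Bbbk|e\rangle$ in degree $e$ with $g$ acting by $1$; $M(\sigma,-)$ with basis $|12\rangle,|23\rangle,|13\rangle$, $|ij\rangle$ of degree $(ij)$, $g|ij\rangle=\mathrm{sgn}(g)|g(ij)g^{-1}\rangle$. A $\mathfrak{D}(\mathbb{S}_3)$-module is of weight $(g,\varrho)$ if it is isomorphic to $M(g,\varrho)$. Let $\mathfrak{D}^{\ge0}$ be the subalgebra generated by $\mathfrak{D}(\mathbb{S}_3)$ and $\overline V$; $M(\sigma,-)$ is a $\mathfrak{D}^{\ge0}$-module with $\overline V$ acting by $0$. The Verma module is $\mathsf{M}(\sigma,-)=\mathfrak{D}\otimes_{\mathfrak{D}^{\ge0}}M(\sigma,-)=\mathfrak{B}(V)\otimes M(\sigma,-)$; write $x|h\rangle$ for $x\otimes|h\rangle$; $\mathsf{S}(\sigma,-)$ is its socle as a $\mathfrak{D}$-module.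 A $\mathfrak{D}$-module is a highest-weight module of weight $(g,\varrho)$ if it is generated by a $\mathfrak{D}(\mathbb{S}_3)$-submodule $M$ of weight $(g,\varrho)$ with $\overline VM=0$. *)

(* Defs.v *)
From HB Require Import structures.
From mathcomp Require Import all_boot all_fingroup all_algebra.
From mathcomp Require Import boolp classical_sets.
From mathcomp Require Import monalg.

Set Implicit Arguments.
Unset Strict Implicit.
Unset Printing Implicit Defensive.

Import GRing.Theory.
Local Open Scope classical_set_scope.
Local Open Scope ring_scope.

Section Submodules.
Variables (A : pzRingType) (V : lmodType A).
Implicit Types (B : set A) (N X Y : set V).

(* When [B] is the underlying set of a subring, [submodule B N] says that [N]
   is a [B]-submodule of the restriction of [V] to [B]. *)
Definition submodule B N : Prop :=
  [/\ N 0,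
      forall v w, N v -> N w -> N (v + w)
    & forall b v, B b -> N v -> N (b *: v)].

Definition submod_span X : set V :=
  [set v | forall N, submodule setT N -> X `<=` N -> N v].

Definition simple_submodule N : Prop :=
  [/\ submodule setT N, N <> [set 0]
    & forall N', submodule setT N' -> N' `<=` N -> N' = [set 0] \/ N' = N].

Definition socle : set V := submod_span (\bigcup_(N in simple_submodule) N).

Definition sumset X Y : set V := [set v + w | v in X & w in Y].

Lemma submod_span_submodule X : submodule setT (submod_span X).
Proof.
split=> [N []//|v w Xv Xw N sN XN|b v _ Xv N sN XN]; have [_ sD sZ] := sN.
- by apply: sD; [apply: Xv | apply: Xw].
- by apply: sZ => //; apply: Xv.
Qed.

Lemma sub_submod_span X : X `<=` submod_span X.
Proof. by move=> v Xv N _; apply. Qed.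

Lemma submod_span_min X N : submodule setT N -> X `<=` N -> submod_span X `<=` N.
Proof. by move=> sN XN v; apply. Qed.

End Submodules.

Arguments socle {A} V.

Section QuotientModule.
Variables (A : pzRingType) (V : lmodType A) (X : set V).

Definition submod_span_pred : {pred V} := fun v => `[< submod_span X v >].

Lemma submod_span_predP v : reflect (submod_span X v) (v \in submod_span_pred).
Proof. exact: asboolP. Qed.

Lemma submod_span_pred_zmod : zmod_closed submod_span_pred.
Proof.
have [s0 sD sZ] := submod_span_submodule X.
split=> [|v w /submod_span_predP Xv /submod_span_predP Xw]; apply/submod_span_predP => //.
by rewrite -scaleN1r; apply: (sD) => //; apply: sZ.
Qed.

HB.instance Definition _ := GRing.isZmodClosed.Build V submod_span_pred submod_span_pred_zmod.

Definition quotmod : Type := Quotient.quot (submod_span_pred : zmodClosed V).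

HB.instance Definition _ := GRing.Zmodule.on quotmod.

Definition qpi (v : V) : quotmod := \pi_(Quotient.quot (submod_span_pred : zmodClosed V))%qT v.

Definition qrepr (q : quotmod) : V :=
  generic_quotient.repr (q : Quotient.quot (submod_span_pred : zmodClosed V)).

Lemma quotmodK q : qpi (qrepr q) = q.
Proof. exact: reprK. Qed.

Lemma qpiP v w : qpi v = qpi w <-> submod_span X (v - w).
Proof.
split=> [/eqP|Xvw]; first by rewrite -Quotient.idealrBE => /submod_span_predP.
by apply/eqP; rewrite -Quotient.idealrBE; apply/submod_span_predP.
Qed.

Lemma qpiD v w : qpi (v + w) = qpi v + qpi w.
Proof. exact: Quotient.pi_add. Qed.

Lemma qpi0 : qpi 0 = 0.
Proof. by apply: (addrI (qpi 0)); rewrite -qpiD !addr0. Qed.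

Definition qscale (a : A) (q : quotmod) : quotmod := qpi (a *: qrepr q).

Lemma qpiZ a v : qpi (a *: v) = qscale a (qpi v).
Proof.
apply/qpiP; rewrite -scalerBr; have [_ _ sZ] := submod_span_submodule X.
by apply: sZ => //; apply/qpiP; rewrite quotmodK.
Qed.

Fact qscaleA a b q : qscale a (qscale b q) = qscale (a * b) q.
Proof. by rewrite -[q]quotmodK -!qpiZ scalerA. Qed.

Fact qscale1 : left_id 1 qscale.
Proof. by move=> q; rewrite -[q]quotmodK -!qpiZ scale1r. Qed.

Fact qscaleDr : right_distributive qscale +%R.
Proof.
by move=> a q r; rewrite -[q]quotmodK -[r]quotmodK -qpiD -!qpiZ -qpiD scalerDr.
Qed.

Fact qscaleDl q : {morph qscale^~ q : a b / a + b}.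
Proof. by move=> a b; rewrite -[q]quotmodK -!qpiZ -qpiD scalerDl. Qed.

HB.instance Definition _ := GRing.Zmodule_isLmodule.Build A quotmod
  qscaleA qscale1 qscaleDr qscaleDl.

End QuotientModule.

(* The quotient of an algebra by the two-sided ideal generated by the elements
   [l - r] for [E l r]. *)
Section QuotientAlgebra.
Variables (k : fieldType) (F : algType k) (E : F -> F -> Prop).

Definition ideal_gens : set F :=
  [set z | exists a b l r, E l r /\ z = a * (l - r) * b].

Definition quotalg : Type := quotmod ideal_gens.
HB.instance Definition _ := GRing.Lmodule.on quotalg.

Definition api (x : F) : quotalg := qpi ideal_gens x.

Lemma apiK (p : quotalg) : api (qrepr p) = p.
Proof. exact: quotmodK. Qed.

Lemma apiD x y : api (x + y) = api x + api y.
Proof. exact: qpiD. Qed.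

Lemma apiZ (c : k) x : api (c *: x) = c *: api x.
Proof. exact: qpiZ. Qed.

Fact ideal_mull a x : submod_span ideal_gens x -> submod_span ideal_gens (a * x).
Proof.
have [s0 sD sZ] := submod_span_submodule ideal_gens.
apply: (@submod_span_min _ _ _ [set x | submod_span ideal_gens (a * x)]) => /=.
  split=> /= [|v w Xv Xw|b v _ Xv]; rewrite ?mulr0 ?mulrDr //.
  - exact: sD.
  - by rewrite -scalerAr; apply: sZ.
move=> _ [b [c [l [r [Elr ->]]]]]; apply: sub_submod_span.
by exists (a * b), c, l, r; rewrite !mulrA.
Qed.

Fact ideal_mulr a x : submod_span ideal_gens x -> submod_span ideal_gens (x * a).
Proof.
have [s0 sD sZ] := submod_span_submodule ideal_gens.
apply: (@submod_span_min _ _ _ [set x | submod_span ideal_gens (x * a)]) => /=.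
  split=> /= [|v w Xv Xw|b v _ Xv]; rewrite ?mul0r ?mulrDl //.
  - exact: sD.
  - by rewrite -scalerAl; apply: sZ.
move=> _ [b [c [l [r [Elr ->]]]]]; apply: sub_submod_span.
by exists b, (c * a), l, r; rewrite !mulrA.
Qed.

Definition quotalg_mul (p q : quotalg) : quotalg := api (qrepr p * qrepr q).

Lemma quotalg_mulE x y : api (x * y) = quotalg_mul (api x) (api y).
Proof.
apply/qpiP; set x' := qrepr _; set y' := qrepr _.
have [_ sD _] := submod_span_submodule ideal_gens.
have -> : x * y - x' * y' = (x - x') * y + x' * (y - y').
  by rewrite mulrBl mulrBr addrA subrK.
apply: sD; [apply: ideal_mulr | apply: ideal_mull]; apply/qpiP;
  by rewrite quotmodK.
Qed.

Fact quotalg_mulA : associative quotalg_mul.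
Proof.
by move=> p q r; rewrite -[p]apiK -[q]apiK -[r]apiK -!quotalg_mulE mulrA.
Qed.

Fact quotalg_mul1r : left_id (api 1) quotalg_mul.
Proof. by move=> p; rewrite -[p]apiK -!quotalg_mulE mul1r. Qed.

Fact quotalg_mulr1 : right_id (api 1) quotalg_mul.
Proof. by move=> p; rewrite -[p]apiK -!quotalg_mulE mulr1. Qed.

Fact quotalg_mulDl : left_distributive quotalg_mul +%R.
Proof.
move=> p q r; rewrite -[p]apiK -[q]apiK -[r]apiK.
by rewrite -apiD -!quotalg_mulE -apiD mulrDl.
Qed.

Fact quotalg_mulDr : right_distributive quotalg_mul +%R.
Proof.
move=> p q r; rewrite -[p]apiK -[q]apiK -[r]apiK.
by rewrite -apiD -!quotalg_mulE -apiD mulrDr.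
Qed.

HB.instance Definition _ := GRing.Zmodule_isPzRing.Build quotalg
  quotalg_mulA quotalg_mul1r quotalg_mulr1 quotalg_mulDl quotalg_mulDr.

Lemma api1 : api 1 = 1.
Proof. by []. Qed.

Lemma apiM x y : api (x * y) = api x * api y.
Proof. exact: quotalg_mulE. Qed.

Lemma api_rel l r : E l r -> api l = api r.
Proof.
move=> Elr; apply/qpiP; apply: sub_submod_span.
by exists 1, 1, l, r; rewrite mul1r mulr1.
Qed.

Fact quotalg_scaleAl (c : k) (p q : quotalg) : c *: (p * q) = c *: p * q.
Proof. by rewrite -[p]apiK -[q]apiK -apiM -!apiZ -apiM scalerAl. Qed.

Fact quotalg_scaleAr (c : k) (p q : quotalg) : c *: (p * q) = p * (c *: q).
Proof. by rewrite -[p]apiK -[q]apiK -apiM -!apiZ -apiM scalerAr. Qed.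

Lemma quotalg_neq0 (chi : F -> k) :
    linear_for *%R chi -> {morph chi : x y / x * y} -> chi 1 = 1 ->
    (forall l r, E l r -> chi l = chi r) ->
  (1 : quotalg) != 0.
Proof.
move=> chi_lin chiM chi1 chiE; apply/eqP => one0.
have chi0 : chi 0 = 0.
  by have := chi_lin (-1) 0 0; rewrite scaler0 addr0 mulN1r addNr.
suff /(_ (1 - 0)) sub : submod_span ideal_gens `<=` [set x | chi x = 0].
  have /sub : submod_span ideal_gens (1 - 0) by apply/qpiP; rewrite qpi0; apply: one0.
  by move/eqP; rewrite subr0 chi1 oner_eq0.
apply: submod_span_min => [|_ [a [b [l [r [/chiE lr ->]]]]]] /=.
  split=> //= [v w v0 w0|c v _ v0].
  - by rewrite -[v]scale1r chi_lin v0 w0 mulr0 addr0.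
  - by rewrite -[_ *: _]addr0 chi_lin v0 chi0 mulr0 addr0.
by rewrite !chiM addrC -scaleN1r chi_lin lr mulN1r addNr mulr0 mul0r.
Qed.

End QuotientAlgebra.

(* The free unital associative k-algebra on [G]. *)
Section FreeAlgebra.
Variables (k : fieldType) (G : choiceType).

Definition freealg : Type := {malg k[{fmonom G}]}.
HB.instance Definition _ := GRing.Lalgebra.on freealg.

Fact freealg_scaleAr (c : k) (x y : freealg) : c *: (x * y) = x * (c *: y).
Proof.
have sub z : finmap.fsubset (msupp z) (msupp z) :=
  finmap.fsubset_refl (@msupp {fmonom G} k z).
apply: (proj1 (malgP _ _)) => m.
rewrite (mcoeffZ c (x * y) m).
rewrite [X in _ * X](mcoeffMlw m (sub x) (sub y)).
rewrite (mcoeffMlw m (sub x) (msuppZ_le c y)).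
rewrite mulr_sumr; apply: eq_bigr => m1 _.
rewrite mulr_sumr; apply: eq_bigr => m2 _.
rewrite mcoeffZ mulrCA; exact: mulrnAr.
Qed.

HB.instance Definition _ :=
  GRing.Lalgebra_isAlgebra.Build k freealg freealg_scaleAr.

Definition fgen (u : G) : freealg := << fmu u >>.

(* The character of the free algebra that takes given values on [G]. *)
Variable w : G -> k.

Definition mon_char (m : {fmonom G}) : k := \prod_(u <- (m : seq G)) w u.

Fact mon_char_mmorphism : mmorphism mon_char.
Proof.
by split=> [m1 m2|]; rewrite /mon_char (fmM, fm1) ?big_cat ?big_nil.
Qed.

HB.instance Definition _ :=
  monalg.isMultiplicative.Build {fmonom G} k mon_char mon_char_mmorphism.

Definition free_char (x : freealg) : k := mmap idfun mon_char x.

Lemma free_char_gen u : free_char (fgen u) = w u.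
Proof. by rewrite /free_char mmapU mul1r /mon_char fmU big_seq1. Qed.

Lemma free_char_linear : linear_for *%R free_char.
Proof.
move=> c x y; rewrite /free_char -(mmapZ (f := idfun) (h := mon_char)).
exact: mmapD.
Qed.

Lemma free_charM : {morph free_char : x y / x * y}.
Proof. by have [fM _] := mmap_is_multiplicative (f := idfun) (h := mon_char). Qed.

Lemma free_char1 : free_char 1 = 1.
Proof. by have [_ f1] := mmap_is_multiplicative (f := idfun) (h := mon_char). Qed.

End FreeAlgebra.

Section Subalgebras.
Variables (k : fieldType) (A : algType k).

Definition subalgebra (B : set A) : Prop :=
  [/\ B 1,
      forall (c : k) a b, B a -> B b -> B (c *: a + b)
    & forall a b, B a -> B b -> B (a * b)].

Definition subalg_gen (X : set A) : set A :=
  [set a | forall B, subalgebra B -> X `<=` B -> B a].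

(* A module over a subalgebra of [A] is given by the operators [f] through
   which generators [a] of the subalgebra act ([P a f]); [act_graph P] is the
   subalgebra of [A] x End(W) that these pairs generate, i.e. the graph of the
   action of the subalgebra. *)
Inductive act_graph (W : lmodType k) (P : A -> (W -> W) -> Prop) :
    A -> (W -> W) -> Prop :=
| act_graph_gen a f : P a f -> act_graph P a f
| act_graph_one : act_graph P 1 id
| act_graph_lin (c : k) a f b g :
    act_graph P a f -> act_graph P b g ->
    act_graph P (c *: a + b) (fun w => c *: f w + g w)
| act_graph_mul a f b g :
    act_graph P a f -> act_graph P b g -> act_graph P (a * b) (f \o g).

Lemma act_graph_domain (W : lmodType k) (P : A -> (W -> W) -> Prop) a :
  (exists f, act_graph P a f) <-> subalg_gen [set b | exists f, P b f] a.
Proof.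
split=> [[f]|]; last first.
  move/(_ [set b | exists f, act_graph P b f]); apply=> [|b [f Pbf]]; last first.
    by exists f; apply: act_graph_gen.
  split=> [|c b b' [f ?] [f' ?]|b b' [f ?] [f' ?]].
  - by exists id; apply: act_graph_one.
  - by exists (fun w => c *: f w + f' w); apply: act_graph_lin.
  - by exists (f \o f'); apply: act_graph_mul.
elim=> {a f} [a f Paf|? []//|c a f b g _ IHa _ IHb|a f b g _ IHa _ IHb] B sB XB.
- by apply: XB; exists f.
- by have [_ + _] := sB; apply; [apply: IHa | apply: IHb].
- by have [_ _] := sB; apply; [apply: IHa | apply: IHb].
Qed.

End Subalgebras.

(* MathComp composes permutations left to right; [pmul g h] is the product
   [gh] in which [h] is applied first. *)
Definition pmul (g h : 'S_3) : 'S_3 := (h * g)%g.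

Lemma pmulE g h i : pmul g h i = g (h i).
Proof. exact: permM. Qed.

Definition is_transp (t : 'S_3) : bool :=
  [exists i, exists j, (i != j) && (t == tperm i j)].

Definition transp : Type := {t : 'S_3 | is_transp t}.
HB.instance Definition _ := Finite.on transp.

Coercion transp_val (t : transp) : 'S_3 := val t.

Fact is_transp_conj (g : 'S_3) (t : transp) : is_transp (pmul (pmul g t) g^-1%g).
Proof.
have /existsP[i /existsP[j /andP[ij /eqP tE]]] := valP t.
apply/existsP; exists (g i); apply/existsP; exists (g j).
by rewrite (inj_eq perm_inj) ij /pmul /transp_val /= tE -conjgE tpermJ eqxx.
Qed.

(* [conjt g t] is [g t g^-1]. *)
Definition conjt (g : 'S_3) (t : transp) : transp :=
  Sub (pmul (pmul g t) g^-1%g) (is_transp_conj g t).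

Lemma transp_neq1 (t : transp) : (t : 'S_3) != 1%g.
Proof.
have /existsP[i /existsP[j /andP[ij /eqP tE]]] := valP t.
rewrite /transp_val tE; apply: contra ij => /eqP/permP/(_ i).
by rewrite tpermL perm1 => ->.
Qed.

(* The points 1, 2, 3 permuted by S_3. *)
Definition p1 : 'I_3 := Ordinal (isT : 0 < 3)%N.
Definition p2 : 'I_3 := Ordinal (isT : 1 < 3)%N.
Definition p3 : 'I_3 := Ordinal (isT : 2 < 3)%N.

Fact is_transp_tperm (i j : 'I_3) : i != j -> is_transp (tperm i j).
Proof.
by move=> ij; apply/existsP; exists i; apply/existsP; exists j; rewrite ij /=.
Qed.

Definition t12 : transp := Sub (tperm p1 p2) (@is_transp_tperm p1 p2 isT).
Definition t23 : transp := Sub (tperm p2 p3) (@is_transp_tperm p2 p3 isT).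
Definition t13 : transp := Sub (tperm p1 p3) (@is_transp_tperm p1 p3 isT).

(* [tp i j] is the transposition (i j); it is only used for [i != j]. *)
Definition tp (i j : 'I_3) : transp := insubd t12 (tperm i j).

Lemma tpE i j : i != j -> tp i j = tperm i j :> 'S_3.
Proof. by move=> ij; rewrite /tp /transp_val insubdK //; apply: is_transp_tperm. Qed.

(* The defining relations of the double [Dfk], in an algebra with elements
   [x t] = x_t, [y t] = y_t, [g s] = s and [d h] = delta_h. *)
Section DoubleRelations.
Variables (k : fieldType) (F : algType k).
Variables (x y : transp -> F) (g d : 'S_3 -> F).
Local Notation sgn s := ((-1) ^+ odd_perm s).

Inductive Drel : F -> F -> Prop :=
| rel_g1 : Drel (g 1%g) 1
| rel_gg s s' : Drel (g s * g s') (g (pmul s s'))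
| rel_dd h : Drel (d h * d h) (d h)
| rel_dd0 h h' : h != h' -> Drel (d h * d h') 0
| rel_dsum : Drel (\sum_h d h) 1
| rel_xx t : Drel (x t * x t) 0
| rel_xxx i j l : uniq [:: i; j; l] ->
    Drel (x (tp i j) * x (tp i l) + x (tp j l) * x (tp i j)
                + x (tp i l) * x (tp j l)) 0
| rel_yy t : Drel (y t * y t) 0
| rel_yyy i j l : uniq [:: i; j; l] ->
    Drel (y (tp i j) * y (tp i l) + y (tp j l) * y (tp i j)
                + y (tp i l) * y (tp j l)) 0
| rel_dg h s : Drel (d h * g s) (g s * d (pmul (pmul s^-1%g h) s))
| rel_gx s t : Drel (g s * x t) (sgn s *: (x (conjt s t) * g s))
| rel_dx h t : Drel (d h * x t) (x t * d (pmul t h))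
| rel_dy h t : Drel (d h * y t) (y t * d (pmul t h))
| rel_yg t s : Drel (y t * g s) (sgn s *: (g s * y (conjt s^-1%g t)))
| rel_yx t : Drel (y t * x t + x t * y t) (1 + g t * (d t - d 1%g))
| rel_yxx i j l : uniq [:: i; j; l] ->
    Drel (y (tp i l) * x (tp i j) + x (tp i j) * y (tp j l))
      (g (tp i j) * (d (tp i l) - d (pmul (tp i l) (tp i j)))).

Fact Drel_counit (chi : F -> k) :
    linear_for *%R chi -> {morph chi : a b / a * b} -> chi 1 = 1 ->
    (forall t, chi (x t) = 0) -> (forall t, chi (y t) = 0) ->
    (forall s, chi (g s) = 1) -> (forall h, chi (d h) = (h == 1%g)%:R) ->
  forall l r, Drel l r -> chi l = chi r.
Proof.
move=> chi_lin chiM chi1 chix chiy chig chid.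
have chi0 : chi 0 = 0.
  by have := chi_lin (-1) 0 0; rewrite scaler0 addr0 mulN1r addNr.
have chiD a b : chi (a + b) = chi a + chi b.
  by rewrite -[a in LHS]scale1r chi_lin mul1r.
have chiZ c a : chi (c *: a) = c * chi a.
  by rewrite -[_ *: _]addr0 chi_lin chi0 addr0.
have chiN a : chi (- a) = - chi a by rewrite -scaleN1r chiZ mulN1r.
have tn1 (t : transp) : ((t : 'S_3) == 1%g) = false := negPf (transp_neq1 t).
have eqJ (s h : 'S_3) : (pmul (pmul s^-1 h) s == 1%g) = (h == 1%g).
  by rewrite /pmul -(conjg_eq1 h s^-1%g) /conjg invgK mulgA.
have neq1 (i j l : 'I_3) :
    uniq [:: i; j; l] -> (pmul (tp i l) (tp i j) == 1%g) = false.
  rewrite /= !inE negb_or => /and3P[/andP[ij il] jl _]; apply: contraNF jl.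
  move=> /eqP/permP/(_ j).
  by rewrite pmulE !tpE // tpermR tpermL perm1 => ->.
move=> l r; case=> {l r}
  [|s s'|h|h h' hh'||t|i j l u|t|i j l u|h s|s t|h t|h t|t s|t|i j l u];
  rewrite ?(chiZ, chiM, chiD, chiN, chi1, chi0, chix, chiy, chig, chid);
  rewrite ?(mul0r, mulr0, mul1r, mulr1, addr0, tn1, eqJ) //.
- by rewrite -natrM mulnb andbb.
- rewrite -natrM mulnb; case: eqP => //= h1; case: eqP => //= h'1.
  by rewrite h1 h'1 eqxx in hh'.
- rewrite (big_morph chi chiD chi0) (bigD1 1%g) //= chid eqxx big1 ?addr0 //.
  by move=> h h1; rewrite chid (negPf h1).
- by rewrite eqxx sub0r subrr.
- by rewrite neq1 // subrr.
Qed.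

End DoubleRelations.

Section DrinfeldDouble.
Variable k : fieldType.
Local Notation sgn s := ((-1) ^+ odd_perm s).

Definition Dgen : Type := (transp + transp) + ('S_3 + 'S_3).
HB.instance Definition _ := Choice.on Dgen.

Definition Dpres : freealg k Dgen -> freealg k Dgen -> Prop :=
  Drel (fun t => fgen k (inl (inl t) : Dgen))
       (fun t => fgen k (inl (inr t) : Dgen))
       (fun s => fgen k (inr (inl s) : Dgen))
       (fun h => fgen k (inr (inr h) : Dgen)).

Definition Dfk : Type := quotalg Dpres.
HB.instance Definition _ := GRing.Lmodule.on Dfk.
HB.instance Definition _ := GRing.PzRing.on Dfk.

Definition counit_gen (u : Dgen) : k :=
  match u with
  | inl _ => 0
  | inr (inl _) => 1
  | inr (inr h) => (h == 1%g)%:R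
  end.

Fact Dfk_neq0 : (1 : Dfk) != 0.
Proof.
apply: (quotalg_neq0 (free_char_linear counit_gen) (free_charM counit_gen)
                     (free_char1 counit_gen)).
apply: (Drel_counit (free_char_linear counit_gen)
  (free_charM counit_gen) (free_char1 counit_gen)) => ?;
  exact: free_char_gen.
Qed.

HB.instance Definition _ :=
  GRing.PzSemiRing_isNonZero.Build Dfk Dfk_neq0.
HB.instance Definition _ :=
  GRing.Lmodule_isLalgebra.Build k Dfk (@quotalg_scaleAl _ _ Dpres).
HB.instance Definition _ :=
  GRing.Lalgebra_isAlgebra.Build k Dfk (@quotalg_scaleAr _ _ Dpres).

Definition Dx (t : transp) : Dfk := api Dpres (fgen k (inl (inl t) : Dgen)).
Definition Dy (t : transp) : Dfk := api Dpres (fgen k (inl (inr t) : Dgen)).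
Definition Dg (s : 'S_3) : Dfk := api Dpres (fgen k (inr (inl s) : Dgen)).
Definition Ddelta (h : 'S_3) : Dfk := api Dpres (fgen k (inr (inr h) : Dgen)).

Definition Vbar : set Dfk := [set \sum_t c t *: Dy t | c in [set: transp -> k]].

Definition DS3 : set Dfk := subalg_gen (range Dg `|` range Ddelta).

Definition Dge0 : set Dfk := subalg_gen (DS3 `|` Vbar).

(* M(e,+), with |e> = 1 *)
Inductive Me_gen : Dfk -> (k^o -> k^o) -> Prop :=
| Me_g g : Me_gen (Dg g) id
| Me_d h : Me_gen (Ddelta h) (fun w => (h == 1%g)%:R *: w).

(* M(sigma,-), with basis the [ket t] *)
Definition Ms : lmodType k := {ffun transp -> k^o}.

Definition ket (t : transp) : Ms := [ffun s => (s == t)%:R].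

Definition Ms_ext (F : transp -> Ms) (w : Ms) : Ms := \sum_t w t *: F t.

Inductive Ms_gen : Dfk -> (Ms -> Ms) -> Prop :=
| Ms_g g : Ms_gen (Dg g) (Ms_ext (fun t => sgn g *: ket (conjt g t)))
| Ms_d h : Ms_gen (Ddelta h) (Ms_ext (fun t => (h == t)%:R *: ket t)).

Inductive Ms_ge0_gen : Dfk -> (Ms -> Ms) -> Prop :=
| Ms_ge0_DS3 a f : act_graph Ms_gen a f -> Ms_ge0_gen a f
| Ms_ge0_Vbar u : Vbar u -> Ms_ge0_gen u (fun=> 0).

(* By the triangular decomposition of [Dfk], this graph is that of an action
   of [Dge0] (see [Ms_ge0_domain]) extending the one of [DS3]. *)
Definition Ms_ge0 : Dfk -> (Ms -> Ms) -> Prop := act_graph Ms_ge0_gen.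

Lemma DS3_act_graph (W : lmodType k) (P : Dfk -> (W -> W) -> Prop) :
  (forall a, (exists f, P a f) <-> (range Dg `|` range Ddelta) a) ->
  forall a, (exists f, act_graph P a f) <-> DS3 a.
Proof.
move=> PE a; rewrite act_graph_domain /DS3.
by rewrite (_ : [set b | _] = range Dg `|` range Ddelta) //; apply/seteqP; split=> b /PE.
Qed.

Lemma Me_domain a : (exists f, act_graph Me_gen a f) <-> DS3 a.
Proof.
apply: DS3_act_graph => {}a; split=> [[f []] s|[] [s _ <-]]; [left|right| |].
- by exists s.
- by exists s.
- by exists id; exact: Me_g.
- by exists (fun w => (s == 1%g)%:R *: w); exact: Me_d.
Qed.

Lemma Ms_domain a : (exists f, act_graph Ms_gen a f) <-> DS3 a.
Proof.
apply: DS3_act_graph => {}a; split=> [[f []] s|[] [s _ <-]]; [left|right| |].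
- by exists s.
- by exists s.
- by exists (Ms_ext (fun t => sgn s *: ket (conjt s t))); exact: Ms_g.
- by exists (Ms_ext (fun t => (s == t)%:R *: ket t)); exact: Ms_d.
Qed.

Lemma Ms_ge0_domain b : (exists f, Ms_ge0 b f) <-> Dge0 b.
Proof.
rewrite act_graph_domain /Dge0.
rewrite (_ : [set a | _] = DS3 `|` Vbar) //; apply/seteqP; split=> a /=.
  by case=> f [{}a {}f af|u Vu]; [left; apply/Ms_domain; exists f | right].
case=> [/Ms_domain[f af]|Va]; first by exists f; exact: Ms_ge0_DS3.
by exists (fun=> 0); exact: Ms_ge0_Vbar.
Qed.

(* The functions [transp -> Dfk] are the tensor product of [Dfk] and
   M(sigma,-) over k: since the [ket t] are a basis, d (x) w is the function
   with values [w t *: d]. *)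
Definition tensor (d : Dfk) (w : Ms) : {ffun transp -> Dfk^o} :=
  [ffun t => (w t : k) *: d].

Definition balanced_rel : set {ffun transp -> Dfk^o} :=
  [set z | exists d b f w,
     Ms_ge0 b f /\ z = tensor (d * b) w - tensor d (f w)].

Definition verma : lmodType Dfk := quotmod balanced_rel.

Definition vket (x : Dfk) (t : transp) : verma :=
  qpi balanced_rel (tensor x (ket t)).

Section HighestWeight.
Variable V : lmodType Dfk.

(* [M] is isomorphic to [W], where [DS3] acts on [W] by the operators that [P]
   generates. *)
Definition of_weight (W : lmodType k) (P : Dfk -> (W -> W) -> Prop)
    (M : set V) : Prop :=
  exists phi : W -> V,
    [/\ forall (c : k) w w', phi (c *: w + w') = c%:A *: phi w + phi w',
        injective phi,
        range phi = M
      & forall a f w, act_graph P a f -> phi (f w) = a *: phi w].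

Definition highest_weight (W : lmodType k) (P : Dfk -> (W -> W) -> Prop)
    (N : set V) : Prop :=
  submodule setT N /\
  exists M : set V,
    [/\ submodule DS3 M, of_weight P M,
        forall u v, Vbar u -> M v -> u *: v = 0
      & submod_span M = N].

End HighestWeight.

Definition ket_e1 : verma := vket (Dx t12) t12 + vket (Dx t23) t23 + vket (Dx t13) t13.

Definition ket_e3 : verma :=
  vket (Dx t13 * Dx t12 * Dx t23) t12 - vket (Dx t12 * Dx t13 * Dx t12) t23
  + vket (Dx t12 * Dx t13 * Dx t23) t13.

(* k acts on [Dfk]-modules through [c%:A]. *)
Definition tline (lambda mu : k) : set verma :=
  [set c%:A *: (lambda%:A *: ket_e1 + mu%:A *: ket_e3) | c in [set: k]].

Definition Tsub (lambda mu : k) : set verma :=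
  sumset (tline lambda mu) (socle verma).

End DrinfeldDouble.

(* Main.v *)
From HB Require Import structures.
Require Import Defs.
From mathcomp Require Import all_boot all_fingroup all_algebra.
From mathcomp Require Import boolp classical_sets.
From mathcomp Require Import monalg.

Set Implicit Arguments.
Unset Strict Implicit.
Unset Printing Implicit Defensive.

Import GRing.Theory.
Local Open Scope classical_set_scope.
Local Open Scope ring_scope.

(* The Verma module is the 36-dimensional space B(V) (x) M(sigma,-).  An explicit
   integral 36-dimensional representation, checked against the relations of the
   double by computation, shows that the elements (monomial in the x's)|t> are a
   basis.  Write top for the top degree element x_12 x_23 x_12 x_13 |12>.  Given a
   nonzero vector v, take a nonzero coordinate of v of lowest degree: B(V) being
   Frobenius, some element of the double sends v to a nonzero multiple of top.
   Hence every nonzero submodule contains top, and the socle is the simple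
   submodule generated by top.  It has dimension 10 and delta_e kills it, whereas
   delta_e fixes |e>^1 and |e>^3, so the socle meets t_(lambda,mu) trivially.
   Finally x_t|e>^1 = y_t|e>^3 and x_t|e>^3 lie in the socle, y_t|e>^1 = 0, and S_3
   fixes |e>^1 and |e>^3; so T_(lambda,mu) is a submodule. *)

(** The double and the Verma module are both quotients by spans of relations: neither comes with a
    normal form, and the triangular decomposition is not taken for granted. Coordinates are
    therefore obtained from two sides. The map [rep_ket] from M(sigma,-) to columns commutes with
    the action of the nonnegative part, so it extends to a map [vcoord] on the induced module; this
    separates vectors. Conversely, the relations of the double push every g, delta and y to the
    right of the x's, and rewriting with the quadratic relations leaves only the chosen monomials,
    so that [vuncoord] recovers a vector from its column. Since [vcoord] is injective, identities in
    the Verma module can be verified on columns. The tables have integer entries because the field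
    is abstract: over the integers each identity is a closed computation, and its image in [k] holds
    over every field. *)

(** * Homomorphisms out of free algebras and their quotients *)

Section FreeAlgebraLift.
Variables (k : fieldType) (G : choiceType) (A : algType k) (w : G -> A).

Definition mon_lift (m : {fmonom G}) : A := \prod_(u <- (m : seq G)) w u.

Fact mon_lift_mmorphism : mmorphism mon_lift.
Proof.
by split=> [m1 m2|]; rewrite /mon_lift (fmM, fm1) ?big_cat ?big_nil.
Qed.

HB.instance Definition _ :=
  monalg.isMultiplicative.Build {fmonom G} A mon_lift mon_lift_mmorphism.

Definition free_lift (x : freealg k G) : A := mmap (GRing.in_alg A) mon_lift x.

Lemma free_lift_gen u : free_lift (fgen k u) = w u.
Proof.
by rewrite /free_lift mmapU /= scale1r mul1r /mon_lift fmU big_seq1.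
Qed.

Lemma free_lift_linear : linear free_lift.
Proof.
move=> c x y; rewrite /free_lift -[c *: mmap _ _ x]mulr_algl.
rewrite -(mmapZ (f := GRing.in_alg A) (h := mon_lift)).
exact: mmapD.
Qed.

Let lift_multiplicative : multiplicative free_lift.
Proof.
(* The target algebra is noncommutative; it is enough that scalars commute with the images of
   monomials. *)
apply: commr_mmap_is_multiplicative => g m m'.
by rewrite /GRing.comm /= mulr_algl mulr_algr.
Qed.

Lemma free_liftM : {morph free_lift : x y / x * y}.
Proof. by have [fM _] := lift_multiplicative. Qed.

Lemma free_lift1 : free_lift 1 = 1.
Proof. by have [_ f1] := lift_multiplicative. Qed.

End FreeAlgebraLift.

Section QuotientAlgebraLift.
Variables (k : fieldType) (F A : algType k) (E : F -> F -> Prop) (f : F -> A).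
Hypotheses (f_lin : linear f) (fM : {morph f : x y / x * y}).
Hypothesis fE : forall l r, E l r -> f l = f r.

Let f0 : f 0 = 0.
Proof. by have := f_lin (-1) 0 0; rewrite scaler0 addr0 scaleN1r addNr. Qed.

Let fD x y : f (x + y) = f x + f y.
Proof. by rewrite -[x in LHS]scale1r f_lin scale1r. Qed.

Let fZ c x : f (c *: x) = c *: f x.
Proof. by rewrite -[_ *: _]addr0 f_lin f0 addr0. Qed.

Definition quot_lift (p : quotalg E) : A := f (qrepr p).

Lemma quot_liftE x : quot_lift (api E x) = f x.
Proof.
suff sub z : submod_span (ideal_gens E) z -> f z = 0.
  by apply: subr0_eq; rewrite -scaleN1r -fZ -fD scaleN1r; apply/sub/qpiP/quotmodK.
apply: (@submod_span_min _ _ _ [set z | f z = 0]) => [|_ [a [b [l [r [/fE lr ->]]]]]] /=.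
  by split=> //= [v w v0 w0|c v _ v0]; [rewrite fD v0 w0 addr0 | rewrite fZ v0 scaler0].
by rewrite !fM fD -scaleN1r fZ lr scaleN1r subrr mulr0 mul0r.
Qed.

Lemma quot_liftD p q : quot_lift (p + q) = quot_lift p + quot_lift q.
Proof. by rewrite -[p]apiK -[q]apiK -apiD !quot_liftE fD. Qed.

Lemma quot_liftZ c p : quot_lift (c *: p) = c *: quot_lift p.
Proof. by rewrite -[p]apiK -apiZ !quot_liftE fZ. Qed.

Lemma quot_liftM p q : quot_lift (p * q) = quot_lift p * quot_lift q.
Proof. by rewrite -[p]apiK -[q]apiK -apiM !quot_liftE fM. Qed.

End QuotientAlgebraLift.

Section Double.
Variable k : fieldType.

(** Reduces stability under the whole double to its four families of generators. A representative in
    the free algebra is a linear combination of words, and each word is a product of generators. *)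
Lemma Dfk_ind (B : set (Dfk k)) :
    B 1 -> (forall (c : k) a b, B a -> B b -> B (c *: a + b)) ->
    (forall a b, B a -> B b -> B (a * b)) ->
    (forall t, B (Dx k t)) -> (forall t, B (Dy k t)) ->
    (forall s, B (Dg k s)) -> (forall h, B (Ddelta k h)) ->
  forall d, B d.
Proof.
move=> B1 Blin BM Bx By Bg Bd d; rewrite -[d]apiK.
have B0 : B 0 by have := Blin (-1) 1 1 B1 B1; rewrite scaleN1r addNr.
have api_sum (I : Type) (r : seq I) (F : I -> freealg k (Dgen : choiceType)) :
    api (@Dpres k) (\sum_(i <- r) F i) = \sum_(i <- r) api (@Dpres k) (F i).
  exact: (big_morph _ (@apiD _ _ _) (@qpi0 _ _ _)).
rewrite [X in api _ X](monalgE (qrepr d)) api_sum; apply: big_ind => // [a b Ba Bb|m _].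
  by rewrite -[a]scale1r; apply: Blin.
set c := mcoeff _ _.
have -> : (<< c *g m >> : freealg k Dgen) = c *: (<< m >> : freealg k Dgen).
  by apply/malgP=> n; rewrite mcoeffZ !mcoeffU mulrnAr mulr1.
rewrite apiZ -[_ *: _]addr0; apply: Blin => //.
move: {c d}m; case=> s.
elim: s => [|u s IHs].
  suff -> : FMonom [::] = @mone {fmonom Dgen} by [].
  by apply: val_inj; rewrite /= fm1.
suff -> : (<< FMonom (u :: s) >> : freealg k Dgen) = fgen k u * << FMonom s >>.
  rewrite apiM; apply: BM => //.
  by case: u => [[t|t]|[t|t]]; [apply: Bx|apply: By|apply: Bg|apply: Bd].
rewrite /fgen; transitivity (<< mmul (fmu u) (FMonom s) >> : {malg k[{fmonom Dgen}]}).
  by congr mkmalgU; apply: val_inj; rewrite /= fmM fmU.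
by rewrite malgM_def fgmulUU mulr1.
Qed.

End Double.

(** * An integral model of the Verma module *)

(* Sparse integer vectors, sorted by index.  The elements e, (12), (23), (13),
   (123), (132) of S_3 are coded by 0, ..., 5, the transpositions (12), (23), (13)
   also by 0, 1, 2; the basis vector [3 * i + t] is the i-th monomial applied to
   |t>; and the generators x_t, y_t, g, delta_h have the codes [t], [3 + t],
   [6 + g], [12 + h]. *)
Definition svec : Type := seq (nat * int).

(** Cancelled entries are removed: as long as no zero coefficient is inserted, a vector has one
    sorted form and the checks can compare by [==]. *)
Fixpoint ins (i : nat) (a : int) (v : svec) : svec :=
  match v with
  | [::] => [:: (i, a)]
  | (j, b) :: v' =>
    if (i < j)%N then (i, a) :: v
    else if i == j then if a + b == 0 then v' else (i, a + b) :: v'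
    else (j, b) :: ins i a v'
  end.

Definition sadd (v w : svec) : svec := foldr (fun p => ins p.1 p.2) w v.
Definition sscale (a : int) (v : svec) : svec := [seq (p.1, a * p.2) | p <- v].
Definition slin (f : nat -> svec) (v : svec) : svec :=
  foldr (fun p => sadd (sscale p.2 (f p.1))) [::] v.

Definition S3_images : seq (seq nat) :=
  [:: [:: 0; 1; 2]; [:: 1; 0; 2]; [:: 0; 2; 1]; [:: 2; 1; 0];
      [:: 1; 2; 0]; [:: 2; 0; 1]]%N.

Definition cmul (c c' : nat) : nat :=
  index [seq nth 0 (nth [::] S3_images c) i | i <- nth [::] S3_images c']%N S3_images.
Definition cinv (c : nat) : nat := nth 0%N [:: 0; 1; 2; 3; 5; 4]%N c.
Definition codd (c : nat) : bool := (0 < c < 4)%N.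
(** The transposition coded [t] has code [t.+1] as an element of S_3, whence the shifts here and
    below. *)
Definition cconj (c t : nat) : nat := (cmul (cmul c t.+1) (cinv c)).-1.

(** The six reduced words in x_12 and x_23, each followed by 1 or x_13. They are sorted by degree,
    which makes the least index of a nonzero coordinate one of lowest degree. *)
Definition monomials : seq (seq nat) :=
  [:: [::]; [:: 0]; [:: 1]; [:: 2]; [:: 0; 1]; [:: 1; 0]; [:: 0; 2]; [:: 1; 2];
      [:: 0; 1; 0]; [:: 0; 1; 2]; [:: 1; 0; 2]; [:: 0; 1; 0; 2]]%N.

(* The products x_l * (monomial i), reduced by the rules x_13 x_12 = - x_12 x_23
   - x_23 x_13, x_13 x_23 = - x_12 x_13 - x_23 x_12, x_23 x_12 x_23 = x_12 x_23 x_12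
   and x_t x_t = 0. *)
Definition xmon : seq (seq svec) :=
  [:: [:: [:: (1%N, 1)]; [::]; [:: (4%N, 1)]; [:: (6%N, 1)]; [::]; [:: (8%N, 1)]; [::];
          [:: (9%N, 1)]; [::]; [::]; [:: (11%N, 1)]; [::]];
      [:: [:: (2%N, 1)]; [:: (5%N, 1)]; [::]; [:: (7%N, 1)]; [:: (8%N, 1)]; [::];
          [:: (10%N, 1)]; [::]; [::]; [:: (11%N, 1)]; [::]; [::]];
      [:: [:: (3%N, 1)]; [:: (4%N, -1); (7%N, -1)]; [:: (5%N, -1); (6%N, -1)]; [::];
          [:: (10%N, 1)]; [:: (9%N, 1)]; [:: (9%N, -1)]; [:: (10%N, -1)]; [:: (11%N, -1)];
          [::]; [::]; [::]]].

Definition xact (l j : nat) : svec :=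
  [seq ((3 * p.1 + j %% 3)%N, p.2) | p <- nth [::] (nth [::] xmon l) (j %/ 3)%N].
Definition word_ket (w : seq nat) (t : nat) : svec :=
  foldr (fun l => slin (xact l)) [:: (t, 1)] w.
(* The exponent is the parity of [size w + 1]: g acts with a sign on the x's and on
   M(sigma,-). *)
Definition gact (c j : nat) : svec :=
  let w := nth [::] monomials (j %/ 3)%N in
  sscale ((-1) ^+ (codd c && ~~ odd (size w)))
    (word_ket [seq cconj c l | l <- w] (cconj c (j %% 3)%N)).
Definition kdeg (j : nat) : nat :=
  foldr (fun l => cmul l.+1) (j %% 3)%N.+1 (nth [::] monomials (j %/ 3)%N).
Definition dact (c j : nat) : svec := if kdeg j == c then [:: (j, 1)] else [::].

(* Moves y_s to the right of the word [w] by the relations between the y's and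
   the x's, which read y_s x_l + x_l y_(lsl) = [s = l] + l (delta_s - delta_(sl)). *)
Fixpoint yword (s : nat) (w : seq nat) (t : nat) : svec :=
  match w with
  | [::] => [::]
  | l :: w' =>
    let v := word_ket w' t in
    sadd (sscale (-1) (slin (xact l) (yword (cconj l.+1 s) w' t)))
      (sadd (if s == l then v else [::])
        (slin (gact l.+1)
          (sadd (slin (dact s.+1) v)
             (sscale (-1) (slin (dact (cmul s.+1 l.+1)) v)))))
  end.
Definition yact (s j : nat) : svec := yword s (nth [::] monomials (j %/ 3)%N) (j %% 3)%N.

(** Stored in evaluated form, so that the checks look entries up instead of straightening words
    again. *)
Definition generator_table : seq (seq svec) := Eval vm_compute in
  [seq [seq xact l j | j <- iota 0 36] | l <- iota 0 3] ++
  [seq [seq yact l j | j <- iota 0 36] | l <- iota 0 3] ++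
  [seq [seq gact c j | j <- iota 0 36] | c <- iota 0 6] ++
  [seq [seq dact c j | j <- iota 0 36] | c <- iota 0 6].

Definition gen_act (u j : nat) : svec := nth [::] (nth [::] generator_table u) j.

Definition spol : Type := seq (int * seq nat).
Definition word_act (w : seq nat) (v : svec) : svec := foldr (fun u => slin (gen_act u)) v w.
Definition spol_act (p : spol) (v : svec) : svec :=
  foldr (fun q => sadd (sscale q.1 (word_act q.2 v))) [::] p.
Definition same_action (p q : spol) : bool :=
  all (fun j => spol_act p [:: (j, 1)] == spol_act q [:: (j, 1)]) (iota 0 36).

Notation Yc t := (3 + t)%N.
Notation Gc c := (6 + c)%N.
Notation Dc c := (12 + c)%N.

(** Points are numbered from 0, so two distinct points have sum 1, 2 or 3 according to whether they
    give (12), (13) or (23), with codes 0, 2, 1. *)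
Definition tcode (i j : nat) : nat := nth 0 [:: 0; 0; 2; 1]%N (i + j).

(** * Computational verification of the relations on the integer tables *)

Lemma check_g1 : same_action [:: (1, [:: Gc 0]%N)] [:: (1, [::])].
Proof. by vm_compute. Qed.

Definition all6 (P : nat -> bool) := all P (iota 0 6).
Definition all3 (P : nat -> bool) := all P (iota 0 3).
Definition all_distinct (P : nat -> nat -> nat -> bool) : bool :=
  all3 (fun i => all3 (fun j => all3 (fun l => uniq [:: i; j; l] ==> P i j l))).

Lemma check_gg : all6 (fun c => all6 (fun c' =>
  same_action [:: (1, [:: Gc c; Gc c']%N) ] [:: (1, [:: Gc (cmul c c')]%N)])).
Proof. by vm_compute. Qed.
Lemma check_dd : all6 (fun c => all6 (fun c' =>
  same_action [:: (1, [:: Dc c; Dc c']%N)]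
    (if c == c' then [:: (1, [:: Dc c]%N)] else [::]))).
Proof. by vm_compute. Qed.
Lemma check_xx : all3 (fun t => same_action [:: (1, [:: t; t]%N)] [::]).
Proof. by vm_compute. Qed.
Lemma check_yy : all3 (fun t => same_action [:: (1, [:: Yc t; Yc t]%N)] [::]).
Proof. by vm_compute. Qed.
Lemma check_xxx : all_distinct (fun i j l =>
  same_action [:: (1, [:: tcode i j; tcode i l]%N); (1, [:: tcode j l; tcode i j]%N);
                  (1, [:: tcode i l; tcode j l]%N)] [::]).
Proof. by vm_compute. Qed.
Lemma check_yyy : all_distinct (fun i j l =>
  same_action [:: (1, [:: Yc (tcode i j); Yc (tcode i l)]%N);
                  (1, [:: Yc (tcode j l); Yc (tcode i j)]%N);
                  (1, [:: Yc (tcode i l); Yc (tcode j l)]%N)] [::]).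
Proof. by vm_compute. Qed.
Lemma check_dg : all6 (fun h => all6 (fun c =>
  same_action [:: (1, [:: Dc h; Gc c]%N)]
    [:: (1, [:: Gc c; Dc (cmul (cmul (cinv c) h) c)]%N)])).
Proof. by vm_compute. Qed.
Lemma check_gx : all6 (fun c => all3 (fun t =>
  same_action [:: (1, [:: Gc c; t]%N)] [:: ((-1) ^+ codd c, [:: cconj c t; Gc c]%N)])).
Proof. by vm_compute. Qed.
Lemma check_dx : all6 (fun h => all3 (fun t =>
  same_action [:: (1, [:: Dc h; t]%N)] [:: (1, [:: t; Dc (cmul t.+1 h)]%N)])).
Proof. by vm_compute. Qed.
Lemma check_dy : all6 (fun h => all3 (fun t =>
  same_action [:: (1, [:: Dc h; Yc t]%N)] [:: (1, [:: Yc t; Dc (cmul t.+1 h)]%N)])).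
Proof. by vm_compute. Qed.
Lemma check_yg : all6 (fun c => all3 (fun t =>
  same_action [:: (1, [:: Yc t; Gc c]%N)]
    [:: ((-1) ^+ codd c, [:: Gc c; Yc (cconj (cinv c) t)]%N)])).
Proof. by vm_compute. Qed.
Lemma check_yx : all3 (fun t =>
  same_action [:: (1, [:: Yc t; t]%N); (1, [:: t; Yc t]%N)]
    [:: (1, [::]); (1, [:: Gc t.+1; Dc t.+1]%N); (-1, [:: Gc t.+1; Dc 0]%N)]).
Proof. by vm_compute. Qed.
Lemma check_yxx : all_distinct (fun i j l =>
  same_action [:: (1, [:: Yc (tcode i l); tcode i j]%N); (1, [:: tcode i j; Yc (tcode j l)]%N)]
    [:: (1, [:: Gc (tcode i j).+1; Dc (tcode i l).+1]%N);
        (-1, [:: Gc (tcode i j).+1; Dc (cmul (tcode i l).+1 (tcode i j).+1)]%N)]).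
Proof. by vm_compute. Qed.
Lemma check_delta_sum :
  same_action [seq (1, [:: Dc c]%N) | c <- iota 0 6] [:: (1, [::])].
Proof. by vm_compute. Qed.

Lemma check_y_ket : all3 (fun s => all3 (fun t => gen_act (Yc s) t == [::])).
Proof. by vm_compute. Qed.
Lemma check_g_ket : all6 (fun c => all3 (fun t =>
  gen_act (Gc c) t == [:: (cconj c t, (-1) ^+ codd c)])).
Proof. by vm_compute. Qed.
Lemma check_d_ket : all6 (fun h => all3 (fun t =>
  gen_act (Dc h) t == if h == t.+1 then [:: (t, 1)] else [::])).
Proof. by vm_compute. Qed.

(** Ties the evaluated table back to [xmon], the form in which [x_basis] derives the action of the
    x's from the relations. *)
Lemma check_x_table : all3 (fun l => all (fun j => gen_act l j == xact l j) (iota 0 36)).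
Proof. by vm_compute. Qed.

Lemma check_x_bound :
  all3 (fun l => all (fun j => all (fun p => p.1 < 36)%N (gen_act l j)) (iota 0 36)).
Proof. by vm_compute. Qed.

(* The dual of the basis of monomials for the Frobenius form of B(V): the i-th
   element sends the monomial [i] to the top one and kills the other monomials of
   the same or a greater degree. *)
Definition top_dual : seq spol :=
  [:: [:: (1, [:: 0; 1; 0; 2]%N)]; [:: (-1, [:: 1; 0; 2]%N)]; [:: (-1, [:: 0; 1; 2]%N)];
      [:: (1, [:: 0; 1; 0]%N)]; [:: (1, [:: 1; 0]%N); (1, [:: 0; 2]%N)];
      [:: (1, [:: 0; 1]%N); (1, [:: 1; 2]%N)]; [:: (1, [:: 0; 1]%N)];
      [:: (1, [:: 1; 0]%N)]; [:: (-1, [:: 2]%N)]; [:: (1, [:: 1]%N)];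
      [:: (1, [:: 0]%N)]; [:: (1, [::])]].

(** The top monomial has degree (12)(23)(12)(13) = e, so its product with |t> still has degree t and
    [Dc] isolates it. The codes 0, 5, 4 are the even permutations conjugating (12), (23), (13) to
    (12); being even, they introduce no sign and lead to index 33, the vector top. *)
Definition detector (j : nat) : spol :=
  [seq (q.1, Gc (nth 0 [:: 0; 5; 4] (j %% 3)) :: Dc (j %% 3).+1 :: q.2)%N
     | q <- nth [::] top_dual (j %/ 3)%N].

Lemma check_detector : all (fun i => all (fun j =>
  spol_act (detector i) [:: (j, 1)] == if i == j then [:: (33%N, 1)] else [::])
  (iota i (36 - i))) (iota 0 36).
Proof. by vm_compute. Qed.

(* The second components form a basis of the socle; the coefficient at the first
   component is the coordinate in this basis. *)
Definition socle_basis : seq (nat * svec) :=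
  [:: (12%N, [:: (12%N, 1); (16%N, 1); (19%N, 1); (21%N, 1)]);
      (13%N, [:: (13%N, 1); (20%N, 1)]);
      (15%N, [:: (15%N, 1); (23%N, 1)]);
      (24%N, [:: (24%N, 1); (31%N, 1)]);
      (25%N, [:: (25%N, 1); (32%N, 1)]);
      (27%N, [:: (27%N, 1); (32%N, -1)]);
      (29%N, [:: (29%N, 1); (31%N, -1)]);
      (33%N, [:: (33%N, 1)]);
      (34%N, [:: (34%N, 1)]);
      (35%N, [:: (35%N, 1)])].

Definition scoef (i : nat) (v : svec) : int :=
  foldr (fun p a => if p.1 == i then p.2 + a else a) 0 v.

(** A zero coefficient is skipped because [sscale 0] would leave entries with coefficient 0 and
    spoil the comparison by [==]. *)
Definition socle_proj (v : svec) : svec :=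
  foldr (fun s => let a := scoef s.1 v in if a == 0 then id else sadd (sscale a s.2))
    [::] socle_basis.

Lemma check_socle_stable : all (fun u => all (fun s =>
  let v := slin (gen_act u) s.2 in v == socle_proj v) socle_basis) (iota 0 18).
Proof. by vm_compute. Qed.

Lemma check_socle_degree : all (fun s => slin (gen_act (Dc 0)) s.2 == [::]) socle_basis.
Proof. by vm_compute. Qed.

Definition e1_vec : svec := [:: (3%N, 1); (7%N, 1); (11%N, 1)].
(** The entries come from straightening: x_13 x_12 x_23 = x_23 x_12 x_13, x_12 x_13 x_12 = - x_12
    x_23 x_13 and x_12 x_13 x_23 = - x_12 x_23 x_12. *)
Definition e3_vec : svec := [:: (26%N, -1); (28%N, 1); (30%N, 1)].

Lemma check_e1 : e1_vec =
  sadd (sadd (slin (gen_act 0) [:: (0%N, 1)]) (slin (gen_act 1) [:: (1%N, 1)]))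
    (slin (gen_act 2) [:: (2%N, 1)]).
Proof. by vm_compute. Qed.

Lemma check_e3 : e3_vec =
  sadd (sadd (word_act [:: 2; 0; 1]%N [:: (0%N, 1)])
          (sscale (-1) (word_act [:: 0; 2; 0]%N [:: (1%N, 1)])))
    (word_act [:: 0; 2; 1]%N [:: (2%N, 1)]).
Proof. by vm_compute. Qed.

(* x_t e1 = y_t e3 and x_t e3 as multiples of the generator of the socle. *)
Definition x_e1 (t : nat) : spol :=
  nth [::] [:: [:: (1, [:: Gc 2; Yc 0; Yc 1]%N)]; [:: (1, [:: Yc 2; Yc 1]%N)];
               [:: (-1, [:: Yc 0; Yc 1]%N)]] t.
Definition x_e3 (t : nat) : spol := [:: (1, [:: Gc (nth 0 [:: 0; 4; 5] t)]%N)].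

Lemma check_x_e : all3 (fun t =>
  [&& slin (gen_act t) e1_vec == spol_act (x_e1 t) [:: (33%N, 1)],
      slin (gen_act t) e3_vec == spol_act (x_e3 t) [:: (33%N, 1)],
      slin (gen_act (Yc t)) e1_vec == [::]
    & slin (gen_act (Yc t)) e3_vec == spol_act (x_e1 t) [:: (33%N, 1)]]).
Proof. by vm_compute. Qed.

Lemma check_g_e : all6 (fun c =>
  (slin (gen_act (Gc c)) e1_vec == e1_vec) && (slin (gen_act (Gc c)) e3_vec == e3_vec)).
Proof. by vm_compute. Qed.

Lemma check_d_e : all6 (fun h =>
  (slin (gen_act (Dc h)) e1_vec == if h == 0%N then e1_vec else [::]) &&
  (slin (gen_act (Dc h)) e3_vec == if h == 0%N then e3_vec else [::])).
Proof. by vm_compute. Qed.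

Lemma check_top : word_act [:: 0; 1; 0; 2]%N [:: (0%N, 1)] = [:: (33%N, 1)].
Proof. by vm_compute. Qed.

(** * The coding of S_3 and of its transpositions *)

Definition perm_images (s : 'S_3) : seq nat := [:: val (s p1); val (s p2); val (s p3)].
Definition code (s : 'S_3) : nat := index (perm_images s) S3_images.
Definition tcode_of (t : transp) : nat := (code t).-1.

Lemma forall_ord3 (P : 'I_3 -> Prop) : P p1 -> P p2 -> P p3 -> forall i, P i.
Proof.
move=> P1 P2 P3 [[|[|[|//]]] i_lt].
- by rewrite (_ : Ordinal _ = p1) //; apply: val_inj.
- by rewrite (_ : Ordinal _ = p2) //; apply: val_inj.
- by rewrite (_ : Ordinal _ = p3) //; apply: val_inj.
Qed.

Lemma perm_images_S3 s : perm_images s \in S3_images.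
Proof.
have: uniq [:: s p1; s p2; s p3] by rewrite /= !inE !(inj_eq perm_inj).
rewrite /perm_images; move: (s p1) (s p2) (s p3).
by do 3!elim/forall_ord3.
Qed.

Lemma code_lt s : (code s < 6)%N.
Proof. by have := perm_images_S3 s; rewrite -index_mem. Qed.

Lemma code_iota s : code s \in iota 0 6.
Proof. by rewrite mem_iota code_lt. Qed.

Lemma code_images s : nth [::] S3_images (code s) = perm_images s.
Proof. exact: nth_index (perm_images_S3 s). Qed.

Lemma nth_perm_images s i : nth 0%N (perm_images s) (val i) = val (s i).
Proof. by move: i; elim/forall_ord3. Qed.

Lemma code_inj : injective code.
Proof.
move=> s s' eq_c; apply/permP=> i; apply: val_inj.
by rewrite -!nth_perm_images -!code_images eq_c.
Qed.

Lemma codeM s s' : code (pmul s s') = cmul (code s) (code s').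
Proof.
rewrite /cmul !code_images /code; congr (index _ _).
by rewrite /perm_images !pmulE /= !nth_perm_images.
Qed.

Lemma code1 : code 1%g = 0%N.
Proof. by rewrite /code /perm_images !perm1. Qed.

Lemma codeV s : code s^-1%g = cinv (code s).
Proof.
have: cmul (code s^-1%g) (code s) = 0%N by rewrite -codeM /pmul mulgV code1.
have/allP/(_ _ (code_iota s))/allP/(_ _ (code_iota s^-1%g)) :
  all6 (fun c => all6 (fun c' => (cmul c' c == 0%N) ==> (c' == cinv c))) by [].
by move=> /implyP + c0; rewrite c0 => /(_ isT)/eqP.
Qed.

Definition S3_elements : seq 'S_3 :=
  [:: 1%g; t12 : 'S_3; t23 : 'S_3; t13 : 'S_3; pmul t12 t23; pmul t23 t12].

Lemma code_t12 : code t12 = 1%N. Proof. by rewrite /code /perm_images !permE. Qed.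
Lemma code_t23 : code t23 = 2%N. Proof. by rewrite /code /perm_images !permE. Qed.
Lemma code_t13 : code t13 = 3%N. Proof. by rewrite /code /perm_images !permE. Qed.

Lemma code_S3_elements c : (c < 6)%N -> code (nth 1%g S3_elements c) = c.
Proof.
by case: c => [|[|[|[|[|[|//]]]]]] _ /=;
  rewrite ?codeM ?code1 ?code_t12 ?code_t23 ?code_t13.
Qed.

Lemma S3_elementsK s : nth 1%g S3_elements (code s) = s.
Proof. by apply: code_inj; rewrite code_S3_elements ?code_lt. Qed.

Lemma odd_perm_code s : odd_perm s = codd (code s).
Proof.
rewrite -[s in LHS]S3_elementsK; move: (code s) (code_lt s).
by case=> [|[|[|[|[|[|//]]]]]] _ /=; rewrite ?odd_permM ?odd_perm1 ?odd_tperm.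
Qed.

Lemma code_transp (t : transp) : code t = (tcode_of t).+1.
Proof.
have /existsP[i /existsP[j /andP[ij /eqP tE]]] := valP t.
have := odd_perm_code t; rewrite [X in odd_perm X]tE odd_tperm ij /tcode_of /codd.
by case: (code t).
Qed.

Lemma tcode_lt t : (tcode_of t < 3)%N.
Proof.
have /existsP[i /existsP[j /andP[ij /eqP tE]]] := valP t.
have := odd_perm_code t; rewrite [X in odd_perm X]tE odd_tperm ij code_transp /codd.
by case/esym/andP.
Qed.

Lemma tcode_iota t : tcode_of t \in iota 0 3.
Proof. by rewrite mem_iota tcode_lt. Qed.

Lemma tcode_inj : injective tcode_of.
Proof.
move=> t t' eq_t; apply: val_inj; apply: code_inj.
by rewrite -!/(transp_val _) !code_transp eq_t.
Qed.

Lemma tcode_conjt s t : tcode_of (conjt s t) = cconj (code s) (tcode_of t).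
Proof.
rewrite /cconj -code_transp -codeV -!codeM /tcode_of.
by congr (code _).-1.
Qed.

Lemma tcode_tp i j : i != j -> tcode_of (tp i j) = tcode i j.
Proof.
move=> ij; rewrite /tcode_of tpE //.
by move: ij; elim/forall_ord3: i; elim/forall_ord3: j => // _;
  rewrite /code /perm_images !permE.
Qed.

Lemma eq_tp t (i j : 'I_3) : i != j -> tcode_of t = tcode i j -> tp i j = t.
Proof. by move=> ij E; apply: tcode_inj; rewrite tcode_tp. Qed.

Lemma forall_transp (P : transp -> Prop) : P t12 -> P t23 -> P t13 -> forall t, P t.
Proof.
move=> P12 P23 P13 t; have [] : [\/ t = t12, t = t23 | t = t13].
  have := tcode_lt t; case E: (tcode_of t) => [|[|[|//]]] _;
    [constructor 1|constructor 2|constructor 3]; apply: tcode_inj;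
    by rewrite E /tcode_of ?code_t12 ?code_t23 ?code_t13.
all: by move=> ->.
Qed.

(** Two distinct transpositions of three points share exactly one point [i]; this brings y_s x_t
    into the form of [rel_yxx]. *)
Lemma transp_tp (s t : transp) : s != t ->
  exists i j l, [/\ uniq [:: i; j; l], t = tp i j & s = tp i l].
Proof.
have c12 : tcode_of t12 = 0%N by rewrite /tcode_of code_t12.
have c23 : tcode_of t23 = 1%N by rewrite /tcode_of code_t23.
have c13 : tcode_of t13 = 2%N by rewrite /tcode_of code_t13.
elim/forall_transp: s; elim/forall_transp: t; rewrite ?eqxx // => _.
- by exists p2, p3, p1; split=> //; apply/esym/eq_tp.
- by exists p1, p3, p2; split=> //; apply/esym/eq_tp.
- by exists p2, p1, p3; split=> //; apply/esym/eq_tp.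
- by exists p3, p1, p2; split=> //; apply/esym/eq_tp.
- by exists p1, p2, p3; split=> //; apply/esym/eq_tp.
- by exists p3, p2, p1; split=> //; apply/esym/eq_tp.
Qed.

Lemma all_distinctP P (i j l : 'I_3) : all_distinct P -> uniq [:: i; j; l] -> P i j l.
Proof.
have ord_iota (m : 'I_3) : val m \in iota 0 3 by rewrite mem_iota ltn_ord.
move=> /allP/(_ _ (ord_iota i))/allP/(_ _ (ord_iota j))/allP/(_ _ (ord_iota l)).
by move=> /implyP Pijl u; apply: Pijl; rewrite -(map_inj_uniq val_inj) in u.
Qed.

Lemma all_mem (r : seq nat) (P : nat -> bool) c : all P r -> c \in r -> P c.
Proof. by move=> /allP + cr; apply. Qed.

(** * From the integer tables to matrices over the field *)

Section Representation.
Variable k : fieldType.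

(* A null vector for [36 <= i]. *)
Definition unit_vec (i : nat) : 'cV[k]_36 := \col_l (l == i :> nat)%:R.

Lemma col_unit_vec (w : 'cV[k]_36) : w = \sum_(j < 36) w j 0 *: unit_vec j.
Proof.
apply/colP=> i; rewrite summxE (bigD1 i) //= big1 => [|j ij]; rewrite !mxE.
  by rewrite eqxx addr0 mulr1.
by rewrite eq_sym val_eqE (negPf ij) mulr0.
Qed.

Definition vec (v : svec) : 'cV[k]_36 := \sum_(p <- v) p.2%:~R *: unit_vec p.1.

Lemma vec_cons p v : vec (p :: v) = p.2%:~R *: unit_vec p.1 + vec v.
Proof. exact: big_cons. Qed.

Lemma vec_ins i a v : vec (ins i a v) = a%:~R *: unit_vec i + vec v.
Proof.
elim: v => [|[j b] v IHv] /=; first by rewrite vec_cons.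
rewrite vec_cons /=; case: ltnP => _; first by rewrite !vec_cons.
case: eqVneq => [->|_]; last by rewrite vec_cons IHv addrCA.
rewrite addrA -scalerDl -intrD; case: eqVneq => [->|_]; last by rewrite vec_cons.
by rewrite scale0r add0r.
Qed.

Lemma vec_add v w : vec (sadd v w) = vec v + vec w.
Proof.
elim: v => [|p v IHv] /=; first by rewrite /vec big_nil add0r.
by rewrite vec_ins IHv vec_cons addrA.
Qed.

Lemma vec_scale a v : vec (sscale a v) = a%:~R *: vec v.
Proof.
rewrite /vec big_map scaler_sumr; apply: eq_bigr => p _.
by rewrite scalerA -intrM.
Qed.

Lemma vec_lin f v : vec (slin f v) = \sum_(p <- v) p.2%:~R *: vec (f p.1).
Proof.
elim: v => [|p v IHv] /=; first by rewrite /vec !big_nil.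
by rewrite vec_add vec_scale IHv big_cons.
Qed.

Definition rep_mx (u : nat) : 'M[k]_36 := \matrix_(i, j) vec (gen_act u j) i 0.

(** Beyond the table the image is zero, and so is [unit_vec]; hence [rep_mx_unit] and the formulas
    built on it carry no bound on indices. *)
Lemma gen_act_default u j : (36 <= j)%N -> gen_act u j = [::].
Proof.
move=> j_ge; apply: nth_default; apply: leq_trans j_ge.
have [u_lt|u_ge] := ltnP u (size generator_table); last by rewrite nth_default.
by have /allP/(_ _ (mem_nth [::] u_lt)) : all (fun r => size r <= 36)%N generator_table.
Qed.

Lemma rep_mx_unit u i : rep_mx u *m unit_vec i = vec (gen_act u i).
Proof.
apply/colP=> l; rewrite mxE.
have [i_lt|i_ge] := ltnP i 36; last first.
  rewrite gen_act_default // /vec big_nil mxE big1 // => j _.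
  by rewrite !mxE ltn_eqF ?mulr0 // (leq_trans (ltn_ord j)).
rewrite (bigD1 (Ordinal i_lt)) //= big1 => [|j]; last first.
  by rewrite -val_eqE /= !mxE => /negPf->; rewrite mulr0.
by rewrite !mxE eqxx mulr1 addr0.
Qed.

Lemma rep_mx_vec u v : rep_mx u *m vec v = vec (slin (gen_act u) v).
Proof.
rewrite vec_lin /vec mulmx_sumr; apply: eq_bigr => p _.
by rewrite -scalemxAr rep_mx_unit.
Qed.

Definition word_mx (w : seq nat) : 'M[k]_36 := \prod_(u <- w) rep_mx u.
Definition spol_mx (p : spol) : 'M[k]_36 := \sum_(q <- p) q.1%:~R *: word_mx q.2.

Lemma word_mx_vec w v : word_mx w *m vec v = vec (word_act w v).
Proof.
rewrite /word_mx; elim: w => [|u w IHw]; first by rewrite big_nil mul1mx.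
by rewrite big_cons -mulmxA IHw rep_mx_vec.
Qed.

Lemma spol_mx_vec p v : spol_mx p *m vec v = vec (spol_act p v).
Proof.
rewrite /spol_mx mulmx_suml; elim: p => [|q p IHp]; first by rewrite /vec !big_nil.
by rewrite big_cons IHp /= vec_add vec_scale -scalemxAl word_mx_vec.
Qed.

Lemma vec_unit i : vec [:: (i, 1)] = unit_vec i.
Proof. by rewrite vec_cons /vec big_nil addr0 scale1r. Qed.

Lemma spol_mx_col p (w : 'cV[k]_36) :
  spol_mx p *m w = \sum_(j < 36) w j 0 *: vec (spol_act p [:: (val j, 1)]).
Proof.
rewrite {1}[w]col_unit_vec mulmx_sumr; apply: eq_bigr => j _.
by rewrite -scalemxAr -vec_unit spol_mx_vec.
Qed.

(** Turns a computed check into an identity over [k]: the columns of both matrices are the images of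
    the same integer vectors. *)
Lemma same_action_mx p q : same_action p q -> spol_mx p = spol_mx q.
Proof.
move=> /allP pq; apply/matrixP=> i j.
have entry (r : spol) : spol_mx r i j = vec (spol_act r [:: (val j, 1)]) i 0.
  rewrite -spol_mx_vec vec_unit mxE (bigD1 j) //= big1 => [|l]; last first.
    by rewrite -val_eqE /= !mxE => /negPf->; rewrite mulr0.
  by rewrite !mxE eqxx mulr1 addr0.
by rewrite !entry; congr (vec _ _ _); apply/eqP/pq; rewrite mem_iota ltn_ord.
Qed.

Let spol_mx0 : spol_mx [::] = 0.
Proof. exact: big_nil. Qed.
Let spol_mx1 q : spol_mx [:: q] = q.1%:~R *: word_mx q.2.
Proof. exact: big_seq1. Qed.
Let spol_mx_cons q q' p :
  spol_mx (q :: q' :: p) = q.1%:~R *: word_mx q.2 + spol_mx (q' :: p).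
Proof. exact: big_cons. Qed.
Let word_mx0 : word_mx [::] = 1.
Proof. exact: big_nil. Qed.
Let word_mx1 u : word_mx [:: u] = rep_mx u.
Proof. exact: big_seq1. Qed.
Let word_mx_cons u u' w : word_mx (u :: u' :: w) = rep_mx u * word_mx (u' :: w).
Proof. exact: big_cons. Qed.
Let spol_mxE :=
  (spol_mx_cons, spol_mx1, spol_mx0, word_mx_cons, word_mx1, word_mx0, scale1r).

Lemma rep_mx_delta_sum : \sum_h rep_mx (12 + code h) = 1 :> 'M[k]_36.
Proof.
rewrite -(big_map code predT (fun c => rep_mx (12 + c))).
rewrite (perm_big (iota 0 6)); last first.
  apply: uniq_perm => [||c]; rewrite ?iota_uniq //.
    by rewrite (map_inj_uniq code_inj) index_enum_uniq.
  apply/mapP/idP=> [[s _ ->]|]; first exact: code_iota.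
  rewrite mem_iota => /code_S3_elements <-.
  by eexists; first exact: mem_index_enum.
have := same_action_mx check_delta_sum.
by rewrite /= !spol_mxE !big_cons big_nil addr0.
Qed.

Fact rep_mx_rel (F : algType k) (f : F -> 'M[k]_36) (x y : transp -> F) (g d : 'S_3 -> F) :
    linear f -> {morph f : a b / a * b} -> f 1 = 1 ->
    (forall t, f (x t) = rep_mx (tcode_of t)) ->
    (forall t, f (y t) = rep_mx (3 + tcode_of t)) ->
    (forall s, f (g s) = rep_mx (6 + code s)) ->
    (forall h, f (d h) = rep_mx (12 + code h)) ->
  forall l r, Drel x y g d l r -> f l = f r.
Proof.
move=> f_lin fM f1 fx fy fg fd.
have f0 : f 0 = 0 by have := f_lin (-1) 0 0; rewrite scaler0 addr0 scaleN1r addNr.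
have fD a b : f (a + b) = f a + f b by rewrite -[a in LHS]scale1r f_lin scale1r.
have fZ c a : f (c *: a) = c *: f a by rewrite -[_ *: _]addr0 f_lin f0 addr0.
have fN a : f (- a) = - f a by rewrite -scaleN1r fZ scaleN1r.
have fE := (fZ, fM, fD, fN, f1, f0, fx, fy, fg, fd).
have cr := code_iota; have tr := tcode_iota.
have sgnE s : (-1) ^+ odd_perm s = ((-1) ^+ codd (code s) : int)%:~R :> k.
  by rewrite odd_perm_code rmorphXn rmorphN1.
have tpE' (i j l : 'I_3) : uniq [:: i; j; l] ->
    [/\ tcode_of (tp i j) = tcode i j, tcode_of (tp i l) = tcode i l
      & tcode_of (tp j l) = tcode j l].
  by rewrite /= !inE negb_or => /and3P[/andP[ij il] jl _]; rewrite !tcode_tp.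
move=> l r; case=> {l r}
  [|s s'|h|h h' hh'||t|i j l u|t|i j l u|h s|s t|h t|h t|t s|t|i j l u];
  rewrite ?fE.
- by have := same_action_mx check_g1; rewrite !spol_mxE code1.
- by have := same_action_mx (all_mem (all_mem check_gg (cr s)) (cr s')); rewrite !spol_mxE codeM.
- by have := same_action_mx (all_mem (all_mem check_dd (cr h)) (cr h)); rewrite eqxx !spol_mxE.
- have := same_action_mx (all_mem (all_mem check_dd (cr h)) (cr h')).
  by rewrite (inj_eq code_inj) (negPf hh') !spol_mxE.
- by rewrite (big_morph f fD f0) -rep_mx_delta_sum; apply: eq_bigr => h _; rewrite fd.
- by have := same_action_mx (all_mem check_xx (tr t)); rewrite !spol_mxE.
- have := same_action_mx (all_distinctP check_xxx u); rewrite !spol_mxE.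
  by have [-> -> ->] := tpE' _ _ _ u; rewrite addrA.
- by have := same_action_mx (all_mem check_yy (tr t)); rewrite !spol_mxE.
- have := same_action_mx (all_distinctP check_yyy u); rewrite !spol_mxE.
  by have [-> -> ->] := tpE' _ _ _ u; rewrite addrA.
- have := same_action_mx (all_mem (all_mem check_dg (cr h)) (cr s)).
  by rewrite !spol_mxE !codeM codeV.
- have := same_action_mx (all_mem (all_mem check_gx (cr s)) (tr t)).
  by rewrite !spol_mxE tcode_conjt sgnE.
- have := same_action_mx (all_mem (all_mem check_dx (cr h)) (tr t)).
  by rewrite !spol_mxE codeM code_transp.
- have := same_action_mx (all_mem (all_mem check_dy (cr h)) (tr t)).
  by rewrite !spol_mxE codeM code_transp.
- have := same_action_mx (all_mem (all_mem check_yg (cr s)) (tr t)).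
  by rewrite !spol_mxE tcode_conjt codeV sgnE.
- have := same_action_mx (all_mem check_yx (tr t)).
  by rewrite !spol_mxE code1 code_transp scaleN1r mulrBr.
- have := same_action_mx (all_distinctP check_yxx u); rewrite !spol_mxE.
  rewrite codeM !code_transp; have [-> -> ->] := tpE' _ _ _ u.
  by rewrite scaleN1r mulrBr.
Qed.
End Representation.

(** * The representation of the double on columns *)

Section VermaModel.
Variable k : fieldType.

Definition gen_code (u : Dgen) : nat :=
  match u with
  | inl (inl t) => tcode_of t
  | inl (inr t) => 3 + tcode_of t
  | inr (inl s) => 6 + code s
  | inr (inr h) => 12 + code h
  end.

Definition free_rep : freealg k (Dgen : choiceType) -> 'M[k]_36 :=
  free_lift (rep_mx k \o gen_code).

Let free_rep_linear : linear free_rep.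
Proof. exact: free_lift_linear. Qed.
Let free_repM : {morph free_rep : x y / x * y}.
Proof. exact: free_liftM. Qed.

Fact free_rep_rel l r : Dpres l r -> free_rep l = free_rep r.
Proof.
apply: rep_mx_rel => [||||?|?|?]; try exact: free_lift_gen.
- exact: free_rep_linear.
- exact: free_repM.
- exact: free_lift1.
- by move=> ?; exact: free_lift_gen.
Qed.

Definition rep : Dfk k -> 'M[k]_36 := @quot_lift _ _ _ (@Dpres k) free_rep.

Lemma repD d d' : rep (d + d') = rep d + rep d'.
Proof. exact: (quot_liftD free_rep_linear free_repM free_rep_rel). Qed.

Lemma repZ c d : rep (c *: d) = c *: rep d.
Proof. exact: (quot_liftZ free_rep_linear free_repM free_rep_rel). Qed.

Lemma repM d d' : rep (d * d') = rep d *m rep d'.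
Proof. exact: (quot_liftM free_rep_linear free_repM free_rep_rel). Qed.

Lemma rep1 : rep 1 = 1%:M.
Proof.
have r1 := quot_liftE free_rep_linear free_repM free_rep_rel 1.
exact: (etrans r1 (free_lift1 _)).
Qed.

Lemma rep0 : rep 0 = 0.
Proof. by rewrite -[0 in LHS](scale0r 0) repZ scale0r. Qed.

Let rep_gen u : rep (api (@Dpres k) (fgen k u)) = rep_mx k (gen_code u).
Proof.
rewrite -[RHS](free_lift_gen (rep_mx k \o gen_code)).
exact: (quot_liftE free_rep_linear free_repM free_rep_rel).
Qed.

Lemma rep_x t : rep (Dx k t) = rep_mx k (tcode_of t).
Proof. exact: rep_gen. Qed.
Lemma rep_y t : rep (Dy k t) = rep_mx k (3 + tcode_of t).
Proof. exact: rep_gen. Qed.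
Lemma rep_g s : rep (Dg k s) = rep_mx k (6 + code s).
Proof. exact: rep_gen. Qed.
Lemma rep_d h : rep (Ddelta k h) = rep_mx k (12 + code h).
Proof. exact: rep_gen. Qed.

Definition rep_ket (w : Ms k) : 'cV[k]_36 := \sum_t (w t : k) *: unit_vec k (tcode_of t).

Lemma rep_ket_linear : linear rep_ket.
Proof.
move=> c w w'; rewrite scaler_sumr -big_split; apply: eq_bigr => t _ /=.
by rewrite !ffunE scalerDl scalerA.
Qed.

Lemma rep_ketZ c w : rep_ket (c *: w) = c *: rep_ket w.
Proof. by rewrite scaler_sumr; apply: eq_bigr => t _; rewrite ffunE scalerA. Qed.

Lemma rep_ket_ket t : rep_ket (ket k t) = unit_vec k (tcode_of t).
Proof.
rewrite /rep_ket (bigD1 t) //= big1 => [|s /negPf st]; rewrite ffunE ?eqxx.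
  by rewrite scale1r addr0.
by rewrite st scale0r.
Qed.

Let rep_ket_ext (F : transp -> Ms k) (M : 'M[k]_36) :
    (forall t, M *m unit_vec k (tcode_of t) = rep_ket (F t)) ->
  forall w, M *m rep_ket w = rep_ket (Ms_ext F w).
Proof.
move=> MF w; rewrite mulmx_sumr /Ms_ext.
have rK0 : rep_ket 0 = 0.
  by have := rep_ket_linear (-1) 0 0; rewrite scaler0 addr0 scaleN1r addNr.
have rKD u v : rep_ket (u + v) = rep_ket u + rep_ket v.
  by rewrite -[u in LHS]scale1r rep_ket_linear scale1r.
rewrite (big_morph rep_ket rKD rK0); apply: eq_bigr => t _.
by rewrite -scalemxAr MF rep_ketZ.
Qed.

(** This intertwining property is the hypothesis of Frobenius reciprocity: it lets [rep_ket] extend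
    to the induced module, the extension being [vcoord]. *)
Lemma rep_Ms_ge0 b f : Ms_ge0 b f -> forall w, rep b *m rep_ket w = rep_ket (f w).
Proof.
elim=> {b f}[b f|w|c a f b g _ IHf _ IHg w|a f b g _ IHf _ IHg w].
- case=> {b f}[b f|u [c _ <-] w]; last first.
    have rep_sum := big_morph rep repD rep0; rewrite rep_sum mulmx_suml.
    rewrite [rep_ket 0]big1 => [|t _]; last by rewrite ffunE scale0r.
    apply: big1 => s _; rewrite repZ rep_y -scalemxAl mulmx_sumr big1 ?scaler0 // => t _.
    rewrite -scalemxAr rep_mx_unit.
    rewrite (eqP (all_mem (all_mem check_y_ket (tcode_iota s)) (tcode_iota t))).
    by rewrite /vec big_nil scaler0.
  elim=> {b f}[b f|w|c a f b g _ IHf _ IHg w|a f b g _ IHf _ IHg w].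
  + case=> {b f}[s|h]; apply: rep_ket_ext => t; [rewrite rep_g|rewrite rep_d].
      rewrite rep_mx_unit (eqP (all_mem (all_mem check_g_ket (code_iota s)) (tcode_iota t))).
      rewrite vec_cons /vec big_nil addr0 -tcode_conjt -rep_ket_ket rep_ketZ.
      by rewrite odd_perm_code rmorphXn rmorphN1.
    rewrite rep_mx_unit (eqP (all_mem (all_mem check_d_ket (code_iota h)) (tcode_iota t))).
    rewrite rep_ketZ rep_ket_ket -code_transp (inj_eq code_inj).
    by case: eqP => _; rewrite /vec ?big_nil ?big_seq1 ?scale0r.
  + by rewrite rep1 mul1mx.
  + by rewrite repD repZ mulmxDl -scalemxAl IHf IHg rep_ket_linear.
  + by rewrite repM -mulmxA IHg IHf.
- by rewrite rep1 mul1mx.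
- by rewrite repD repZ mulmxDl -scalemxAl IHf IHg rep_ket_linear.
- by rewrite repM -mulmxA IHg IHf.
Qed.

End VermaModel.

(* Stated for abstract modules because unification is slow at [Dfk]. *)
Section AbstractModules.
Variables (k : fieldType) (A : algType k) (V : lmodType A).
Implicit Types (a b : k) (c d e : A) (v w : V).

Lemma scale_swap c d e e' f g v :
  (c + d * (e - e') - f * g) *: v = c *: v + d *: (e *: v - e' *: v) - f *: (g *: v).
Proof. by rewrite scalerBl scalerDl -!scalerA scalerBl. Qed.

Lemma scale_algC d a v : d *: (a%:A *: v) = a%:A *: (d *: v).
Proof. by rewrite !scalerA mulr_algl mulr_algr. Qed.

Lemma scale_alg_comb d a b v w :
  d *: (a%:A *: v + b%:A *: w) = a%:A *: (d *: v) + b%:A *: (d *: w).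
Proof. by rewrite scalerDr !scale_algC. Qed.

Lemma scale_alg_comb0 a b : a%:A *: 0 + b%:A *: 0 = 0 :> V.
Proof. by rewrite !scaler0 addr0. Qed.

Lemma scale_algM a b v : (a * b)%:A *: v = a%:A *: (b%:A *: v).
Proof. by rewrite scalerA mulr_algl scalerA. Qed.

Lemma scale_algD a b v : (a + b)%:A *: v = a%:A *: v + b%:A *: v.
Proof. by rewrite scalerDl scalerDl. Qed.

Lemma scale_alg_lin a c d v : (a *: c + d) *: v = a%:A *: (c *: v) + d *: v.
Proof. by rewrite scalerDl scalerA mulr_algl. Qed.

Lemma scale_alg_addrACA a b v w w' :
  (a + b)%:A *: v + (w + w') = (a%:A *: v + w) + (b%:A *: v + w').
Proof. by rewrite scale_algD addrACA. Qed.

Lemma scale_alg_combM a b v w : a%:A *: (b%:A *: v + w) = (a * b)%:A *: v + a%:A *: w.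
Proof. by rewrite scalerDr scale_algM. Qed.

Lemma scale_alg_combr d a v w : d *: (a%:A *: v + w) = a%:A *: (d *: v) + d *: w.
Proof. by rewrite scalerDr scale_algC. Qed.

Lemma scale_alg0 v w : (0 : k)%:A *: v + w = w.
Proof. by rewrite !scale0r add0r. Qed.

Lemma scale_alg1 v : (1 : k)%:A *: v + 0 = v.
Proof. by rewrite !scale1r addr0. Qed.

Lemma scale_alg10 v : (1 : k)%:A *: 0 + (0 : k)%:A *: v = 0.
Proof. by rewrite scaler0 !scale0r addr0. Qed.

Lemma scale_alg_kill a b d v : d *: v = 0 -> (a *: d) *: (b%:A *: v) = 0.
Proof. by move=> dv; rewrite scale_algC -[a *: d]mulr_algl -scalerA dv !scaler0. Qed.

Lemma scale_alg_linl a b (c : k) v : (a * b + c)%:A *: v = a%:A *: (b%:A *: v) + c%:A *: v.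
Proof. by rewrite scale_algD scale_algM. Qed.

Lemma scale_algB a b v : (a - b)%:A *: v = a%:A *: v - b%:A *: v.
Proof. by rewrite scalerBl scalerBl. Qed.

Lemma scale_alg_eq0 a v : a != 0 -> a%:A *: v = 0 -> v = 0.
Proof.
move=> a0 av; rewrite -[v]scale1r -[1]scale1r -(mulVf a0) scale_algM av.
exact: scaler0.
Qed.

Lemma scale_alg_int (z : int) v : (z%:~R : k)%:A *: v = (z%:~R : A) *: v.
Proof. by rewrite scaler_int. Qed.

End AbstractModules.

(** * Coordinates on the Verma module *)

Section VermaCoordinates.
Variable k : fieldType.
Local Notation rep := (@rep k).

Definition tensor_coord (z : {ffun transp -> (Dfk k)^o}) : 'cV[k]_36 :=
  \sum_t rep (z t) *m unit_vec k (tcode_of t).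

Lemma tensor_coordD z z' : tensor_coord (z + z') = tensor_coord z + tensor_coord z'.
Proof.
by rewrite -big_split; apply: eq_bigr => t _; rewrite /= ffunE repD mulmxDl.
Qed.

Lemma tensor_coordZ d z : tensor_coord (d *: z) = rep d *m tensor_coord z.
Proof.
by rewrite mulmx_sumr; apply: eq_bigr => t _; rewrite ffunE repM mulmxA.
Qed.

Lemma tensor_coord_tensor d w : tensor_coord (tensor d w) = rep d *m rep_ket w.
Proof.
rewrite /tensor_coord /rep_ket mulmx_sumr; apply: eq_bigr => t _.
by rewrite ffunE repZ -scalemxAl -scalemxAr.
Qed.

Definition vcoord (v : verma k) : 'cV[k]_36 := tensor_coord (qrepr v).

(** Independence of the representative: [rep_Ms_ge0] makes the balanced relations vanish in
    coordinates. *)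
Lemma vcoord_qpi z : vcoord (qpi (@balanced_rel k) z) = tensor_coord z.
Proof.
have tB z1 z2 : tensor_coord (z1 - z2) = tensor_coord z1 - tensor_coord z2.
  apply: (addIr (tensor_coord z2)).
  by rewrite -tensor_coordD !subrK.
suff sub z0 : submod_span (@balanced_rel k) z0 -> tensor_coord z0 = 0.
  by apply: subr0_eq; rewrite -tB; apply/sub/qpiP/quotmodK.
apply: (@submod_span_min _ _ _ [set z | tensor_coord z = 0]).
  split=> /= [|z1 z2 z10 z20|d z1 _ z10].
  - by rewrite /tensor_coord big1 // => t _; rewrite ffunE rep0 mul0mx.
  - by rewrite tensor_coordD z10 z20 addr0.
  - by rewrite tensor_coordZ z10 mulmx0.
move=> _ [d [b [f [w [bf ->]]]]] /=.
have db : tensor_coord (tensor (d * b) w) = rep d *m (rep b *m rep_ket w).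
  by rewrite mulmxA -repM; exact: tensor_coord_tensor.
have df := tensor_coord_tensor d (f w).
apply: etrans (tB _ _) (etrans (congr2 (fun x y => x - y) db df) _).
by rewrite (rep_Ms_ge0 bf) subrr.
Qed.

Lemma vcoordD v w : vcoord (v + w) = vcoord v + vcoord w.
Proof. by rewrite -[v]quotmodK -[w]quotmodK -qpiD !vcoord_qpi tensor_coordD. Qed.

Lemma vcoordZ d v : vcoord (d *: v) = rep d *m vcoord v.
Proof.
rewrite -[v]quotmodK -[d *: _]/(qscale d _) -qpiZ !vcoord_qpi.
exact: tensor_coordZ.
Qed.

Lemma vcoordZl (c : k) v : vcoord (c%:A *: v) = c *: vcoord v.
Proof. by rewrite vcoordZ repZ rep1 -scalemxAl mul1mx. Qed.

Lemma vcoord_vket d t : vcoord (vket d t) = rep d *m unit_vec k (tcode_of t).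
Proof. by rewrite vcoord_qpi tensor_coord_tensor rep_ket_ket. Qed.

Lemma tensorZ (d : Dfk k) w : tensor d w = d *: tensor 1 w.
Proof. by apply/ffunP=> s; rewrite !ffunE /GRing.scale /= mulr_algr. Qed.

Lemma vketE (d : Dfk k) t : vket d t = d *: vket 1 t.
Proof. by rewrite /vket tensorZ; exact: qpiZ. Qed.

Lemma vket_ge0 (b : Dfk k) f t : Ms_ge0 b f ->
  b *: vket (1 : Dfk k) t = \sum_s (f (ket k t) s : k)%:A *: vket 1 s.
Proof.
move=> bf; rewrite -vketE.
have qsum (I : Type) (r : seq I) F :
    qpi (@balanced_rel k) (\sum_(i <- r) F i) = \sum_(i <- r) qpi (@balanced_rel k) (F i).
  exact: (big_morph _ (@qpiD _ _ _) (@qpi0 _ _ _)).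
transitivity (qpi (@balanced_rel k) (tensor 1 (f (ket k t)))).
  apply/qpiP; apply: sub_submod_span; exists 1, b, f, (ket k t).
  by rewrite mul1r.
rewrite [tensor 1 _](_ : _ = \sum_s (f (ket k t) s : k)%:A *: tensor 1 (ket k s)).
  by rewrite qsum; apply: eq_bigr => s _; exact: qpiZ.
apply/ffunP=> r; rewrite sum_ffunE (bigD1 r) //= big1 => [|s]; last first.
  by rewrite eq_sym !ffunE => /negPf->; rewrite scale0r scaler0.
by rewrite !ffunE eqxx addr0 scale1r /GRing.scale /= mulr1.
Qed.

Lemma Dgx s t : Dg k s * Dx k t = (-1) ^+ odd_perm s *: (Dx k (conjt s t) * Dg k s).
Proof. by rewrite -!apiM -apiZ; apply: api_rel; exact: rel_gx. Qed.

Lemma Ddx h t : Ddelta k h * Dx k t = Dx k t * Ddelta k (pmul t h).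
Proof. by rewrite -!apiM; apply: api_rel; exact: rel_dx. Qed.

Lemma apiB (x y : freealg k (Dgen : choiceType)) :
  api (@Dpres k) (x - y) = api (@Dpres k) x - api (@Dpres k) y.
Proof. by apply: (addIr (api (@Dpres k) y)); rewrite -apiD !subrK. Qed.

Lemma Dyx t : Dy k t * Dx k t + Dx k t * Dy k t = 1 + Dg k t * (Ddelta k t - Ddelta k 1%g).
Proof. by rewrite -apiB -!apiM -api1 -!apiD; apply: api_rel; exact: rel_yx. Qed.

Lemma Dyxx i j l : uniq [:: i; j; l] ->
  Dy k (tp i l) * Dx k (tp i j) + Dx k (tp i j) * Dy k (tp j l) =
    Dg k (tp i j) * (Ddelta k (tp i l) - Ddelta k (pmul (tp i l) (tp i j))).
Proof. by move=> u; rewrite -apiB -!apiM -!apiD; apply: api_rel; exact: rel_yxx. Qed.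

(** Gives the cases s = t and s <> t one shape. The stability argument in [verma_ind] uses only this
    shape, not the indices. *)
Lemma Dyx_swap s t : exists s' h h' (c : k), 
  Dy k s * Dx k t = c%:A + Dg k t * (Ddelta k h - Ddelta k h') - Dx k t * Dy k s'.
Proof.
have [->|/transp_tp[i [j [l [u -> ->]]]]] := eqVneq s t.
  by exists t, t, 1%g, 1; rewrite scale1r -Dyx addrK.
exists (tp j l), (tp i l), (pmul (tp i l) (tp i j)), 0.
by rewrite scale0r add0r -Dyxx // addrK.
Qed.

Lemma verma_span_kets (P : set (verma k)) :
    P 0 -> (forall (c : k) v w, P v -> P w -> P (c%:A *: v + w)) ->
    (forall t d, P (d *: vket 1 t)) -> forall v, P v.
Proof.
move=> P0 Plin Pket v; rewrite -[v]quotmodK.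
have -> : qrepr v = \sum_t (qrepr v t : Dfk k) *: tensor 1 (ket k t).
  apply/ffunP=> r; rewrite sum_ffunE (bigD1 r) //= big1 => [|s]; last first.
    by rewrite eq_sym !ffunE => /negPf->; rewrite scale0r scaler0.
  by rewrite !ffunE eqxx addr0 scale1r /GRing.scale /= mulr1.
rewrite (big_morph _ (@qpiD _ _ _) (@qpi0 _ _ _)).
apply: big_ind => // [u w Pu Pw|t _].
  by rewrite -[u]scale1r -[1]scale1r; apply: Plin.
have -> : qpi (@balanced_rel k) ((qrepr v t : Dfk k) *: tensor 1 (ket k t)) =
  (qrepr v t : Dfk k) *: vket 1 t by exact: qpiZ.
exact: Pket.
Qed.

(** The spanning half of the triangular decomposition: B(V) alone generates the module from the
    kets. The smallest subspace [N] that contains the kets and is stable under the x's is shown to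
    be stable under the whole double. *)
Lemma verma_ind (P : set (verma k)) :
    P 0 -> (forall (c : k) v w, P v -> P w -> P (c%:A *: v + w)) ->
    (forall t, P (vket 1 t)) -> (forall t v, P v -> P (Dx k t *: v)) ->
  forall v, P v.
Proof.
pose closed (Q : set (verma k)) := [/\ Q 0,
  forall (c : k) v w, Q v -> Q w -> Q (c%:A *: v + w),
  forall t, Q (vket 1 t) & forall t v, Q v -> Q (Dx k t *: v)].
pose N v := forall Q, closed Q -> Q v.
have N0 : N 0 by move=> Q [].
have Nlin (c : k) v w : N v -> N w -> N (c%:A *: v + w).
  by move=> Nv Nw Q cQ; have [_ + _ _] := cQ; apply; [apply: Nv | apply: Nw].
have Nket t : N (vket 1 t) by move=> Q [].
have Nx t v : N v -> N (Dx k t *: v).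
  by move=> Nv Q cQ; have [_ _ _] := cQ; apply; apply: Nv.
have ND v w : N v -> N w -> N (v + w).
  by move=> Nv Nw; rewrite -[v]scale1r -[1]scale1r; apply: Nlin.
have NZ (c : k) v : N v -> N (c%:A *: v).
  by move=> Nv; rewrite -[_ *: _]addr0; apply: Nlin.
have NB v w : N v -> N w -> N (v - w).
  by move=> Nv Nw; rewrite addrC -scaleN1r -[1]scale1r -scaleNr; apply: Nlin.
have Nge0 b f t : Ms_ge0 b f -> N (b *: vket 1 t).
  move=> /vket_ge0->; apply: big_ind => // s _; exact: NZ.
(* A whole family of operators is treated at once because moving one of them past x_t may replace it
   by another member of the family. *)
have N_stable (I : Type) (b : I -> Dfk k) :
    (forall i t, N (b i *: vket 1 t)) ->
    (forall i t v, N v -> (forall j, N (b j *: v)) -> N (b i *: (Dx k t *: v))) ->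
    forall i v, N v -> N (b i *: v).
  move=> bket bx i v /(_ [set v | N v /\ forall i, N (b i *: v)])[|_ //].
  split=> /= [|c u w [Nu Nbu] [Nw Nbw]|t|t w [Nw Nbw]].
  - by split=> // j; rewrite scaler0.
  - by split=> [|j]; [exact: Nlin|rewrite scalerDr scale_algC; exact: Nlin].
  - by [].
  - by split=> [|j]; [exact: Nx|exact: bx].
have Ng : forall s v, N v -> N (Dg k s *: v).
  apply: N_stable => [s t|s t v Nv Ngv].
    exact: Nge0 (act_graph_gen (Ms_ge0_DS3 (act_graph_gen (Ms_g k s)))).
  by rewrite scalerA Dgx -mulr_algl -!scalerA; apply: NZ (Nx _ _ (Ngv s)).
have Nd : forall h v, N v -> N (Ddelta k h *: v).
  apply: N_stable => [h t|h t v Nv Ndv].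
    exact: Nge0 (act_graph_gen (Ms_ge0_DS3 (act_graph_gen (Ms_d k h)))).
  by rewrite scalerA Ddx -scalerA; apply: Nx (Ndv _).
(* The y's come last: exchanging y and x creates terms in g and delta, whose stability must be
   known. *)
have Ny : forall s v, N v -> N (Dy k s *: v).
  apply: N_stable => [s t|s t v Nv Nyv].
    apply: Nge0; apply: act_graph_gen; apply: Ms_ge0_Vbar.
    exists (fun t => (t == s)%:R) => //; rewrite (bigD1 s) //= eqxx scale1r.
    by rewrite big1 ?addr0 // => r /negPf->; rewrite scale0r.
  have [s' [h [h' [c E]]]] := Dyx_swap s t.
  rewrite scalerA E scale_swap.
  apply: (NB _ _ (ND _ _ (NZ _ _ Nv) (Ng _ _ _)) (Nx _ _ (Nyv _))).
  exact: NB (Nd _ _ Nv) (Nd _ _ Nv).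
move=> P0 Plin Pket Px v; suff: N v by apply.
move: v; apply: verma_span_kets => // t d; move: (vket 1 t) (Nket t).
move: d; apply: (@Dfk_ind _ [set d | forall v, N v -> N (d *: v)]) => /=.
- by move=> v; rewrite scale1r.
- move=> c a b Na Nb v Nv; rewrite scalerDl -mulr_algl -scalerA.
  by apply: Nlin; [exact: Na|exact: Nb].
- by move=> a b Na Nb v Nv; rewrite -scalerA; apply: Na (Nb _ Nv).
- by move=> t' v; exact: Nx.
- by move=> t' v; exact: Ny.
- by move=> t' v; exact: Ng.
- by move=> t' v; exact: Nd.
Qed.
End VermaCoordinates.

Definition transps : seq transp := [:: t12; t23; t13].

Lemma transpsK t : nth t12 transps (tcode_of t) = t.
Proof. by elim/forall_transp: t; rewrite /tcode_of ?code_t12 ?code_t23 ?code_t13. Qed.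

(** * Straightening in the Fomin-Kirillov algebra *)

Section FominKirillov.
Variables (A : pzRingType) (V : lmodType A) (x : nat -> A).
Hypotheses (x00 : x 0%N * x 0%N = 0) (x11 : x 1%N * x 1%N = 0) (x22 : x 2%N * x 2%N = 0).
Hypothesis x02 : x 0%N * x 2%N + x 1%N * x 0%N + x 2%N * x 1%N = 0.
Hypothesis x20 : x 2%N * x 0%N + x 1%N * x 2%N + x 0%N * x 1%N = 0.

Definition word_scale (w : seq nat) (v : V) : V := foldr (fun l u => x l *: u) v w.

(** The table [xmon] follows from the quadratic relations in any module, so the twelve monomials
    applied to a vector span a subspace stable under the x's. *)
Lemma word_scale_monomials l i v : (l < 3)%N -> (i < 12)%N ->
  x l *: word_scale (nth [::] monomials i) v =
  \sum_(p <- nth [::] (nth [::] xmon l) i)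
     p.2%:~R *: word_scale (nth [::] monomials p.1) v.
Proof.
have E00 (u : V) : x 0%N *: (x 0%N *: u) = 0 by rewrite scalerA x00 scale0r.
have E11 (u : V) : x 1%N *: (x 1%N *: u) = 0 by rewrite scalerA x11 scale0r.
have E22 (u : V) : x 2%N *: (x 2%N *: u) = 0 by rewrite scalerA x22 scale0r.
have E21 (u : V) : x 2%N *: (x 1%N *: u) = - (x 0%N *: (x 2%N *: u)) - x 1%N *: (x 0%N *: u).
  have := congr1 (fun a => a *: u) x02; rewrite !scalerDl -!scalerA scale0r => /eqP.
  by rewrite addrC addr_eq0 opprD => /eqP.
have E20 (u : V) : x 2%N *: (x 0%N *: u) = - (x 1%N *: (x 2%N *: u)) - x 0%N *: (x 1%N *: u).
  have := congr1 (fun a => a *: u) x20; rewrite !scalerDl -!scalerA scale0r => /eqP.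
  by rewrite -addrA addr_eq0 opprD => /eqP.
(* The braid relation is cubic and comes from an overlap: x_13 x_12 x_12 is zero, and it is also
   rewritten by the rule for x_13 x_12. *)
have E101 (u : V) : x 1%N *: (x 0%N *: (x 1%N *: u)) = x 0%N *: (x 1%N *: (x 0%N *: u)).
  have := E20 (x 0%N *: u); rewrite E00 scaler0 E20 scalerBr scalerN E11 oppr0 sub0r opprK.
  by move=> /esym/eqP; rewrite subr_eq0 => /eqP.
have E := (scalerBr, scalerDr, scalerN, E00, E11, E22, E21, E20, E101, scaler0).
case: l => [|[|[|//]]] _; do 12?[case: i => [|i]] => // _;
  rewrite /= ?big_cons ?big_nil /= ?E ?mulr1z ?mulrN1z ?scaleN1r ?scale1r ?addr0;
  rewrite ?(oppr0, subr0, sub0r, opprK) //; exact: addrC.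
Qed.
End FominKirillov.

(** * Recovering a vector from its coordinates *)

Section CoordinateInverse.
Variable k : fieldType.
Local Notation x l := (Dx k (nth t12 transps l)).

Lemma api0 : api (@Dpres k) 0 = 0.
Proof. exact: qpi0. Qed.

Lemma Dxx t : Dx k t * Dx k t = 0.
Proof. by rewrite -apiM -api0; apply: api_rel; exact: rel_xx. Qed.

Lemma Dxxx i j l : uniq [:: i; j; l] ->
  Dx k (tp i j) * Dx k (tp i l) + Dx k (tp j l) * Dx k (tp i j)
    + Dx k (tp i l) * Dx k (tp j l) = 0.
Proof. by move=> u; rewrite -!apiM -!apiD -api0; apply: api_rel; exact: rel_xxx. Qed.

(* Failing unification problems would otherwise unfold these to the quotients. *)
Opaque Dx Dy Dg Ddelta.

Definition basis (j : nat) : verma k :=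
  word_scale (fun l => x l) (nth [::] monomials (j %/ 3)%N) (vket 1 (nth t12 transps (j %% 3)%N)).

Lemma x_basis l j : (l < 3)%N -> (j < 36)%N ->
  x l *: basis j = \sum_(p <- gen_act l j) (p.2%:~R : Dfk k) *: basis p.1.
Proof.
move=> l3 j36.
have E12 : tp p1 p2 = t12 by apply: eq_tp; rewrite // /tcode_of code_t12.
have E21 : tp p2 p1 = t12 by apply: eq_tp; rewrite // /tcode_of code_t12.
have E23 : tp p2 p3 = t23 by apply: eq_tp; rewrite // /tcode_of code_t23.
have E32 : tp p3 p2 = t23 by apply: eq_tp; rewrite // /tcode_of code_t23.
have E13 : tp p1 p3 = t13 by apply: eq_tp; rewrite // /tcode_of code_t13.
have l_iota : l \in iota 0 3 by rewrite mem_iota.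
have j_iota : j \in iota 0 36 by rewrite mem_iota.
rewrite (eqP (all_mem (all_mem check_x_table l_iota) j_iota)).
have R02 : x 0%N * x 2%N + x 1%N * x 0%N + x 2%N * x 1%N = 0.
  by have := @Dxxx p1 p2 p3 isT; rewrite E12 E13 E23.
have R20 : x 2%N * x 0%N + x 1%N * x 2%N + x 0%N * x 1%N = 0.
  by have := @Dxxx p1 p3 p2 isT; rewrite E12 E13 E32.
have FK := @word_scale_monomials _ (verma k) (fun l => x l) (Dxx _) (Dxx _) (Dxx _) R02 R20.
have j12 : (j %/ 3 < 12)%N by rewrite ltn_divLR.
apply: etrans (FK _ _ _ l3 j12) _; rewrite big_map.
apply: eq_bigr => p _; congr (_ *: word_scale _ (nth _ _ _) (vket _ (nth _ _ _))).
- by rewrite mulnC divnMDl // divn_small ?addn0 // ltn_mod.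
- by rewrite mulnC modnMDl modn_mod.
Qed.

Lemma basis_ket t : basis (tcode_of t) = vket 1 t.
Proof.
have t3 := tcode_lt t; rewrite /basis (divn_small t3) (modn_small t3) transpsK.
reflexivity.
Qed.

Opaque basis.

Definition vuncoord (w : 'cV[k]_36) : verma k := \sum_(j < 36) (w j 0)%:A *: basis j.

Lemma vuncoordD w w' : vuncoord (w + w') = vuncoord w + vuncoord w'.
Proof.
rewrite -big_split; apply: eq_bigr => j _ /=; rewrite mxE.
exact: scale_algD.
Qed.

Lemma vuncoordZ (c : k) w : vuncoord (c *: w) = c%:A *: vuncoord w.
Proof.
rewrite scaler_sumr; apply: eq_bigr => j _; rewrite mxE.
exact: scale_algM.
Qed.

Lemma vuncoord_unit j : (j < 36)%N -> vuncoord (unit_vec k j) = basis j.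
Proof.
move=> j36; rewrite /vuncoord (bigD1 (Ordinal j36)) //= big1 => [|i].
  by rewrite mxE eqxx !scale1r addr0.
by rewrite -val_eqE mxE /= => /negPf->; rewrite !scale0r.
Qed.

(** By [verma_ind] only the kets and the x's matter, and x_t acts on [basis] and on columns by the
    same table. The resulting injectivity lets later identities be checked on columns. *)
Lemma vcoordK : cancel (@vcoord k) vuncoord.
Proof.
have u0 : vuncoord 0 = 0 by rewrite -[0 in LHS](scale0r 0) vuncoordZ !scale0r.
have c0 : vcoord (0 : verma k) = 0.
  by rewrite -[0 in LHS](scale0r (0 : verma k)) vcoordZ rep0 mul0mx.
apply: (@verma_ind k [set v | vuncoord (vcoord v) = v]) => /= [|c v w vK wK|t|t v vK].
- by rewrite c0 u0.
- by rewrite vcoordD vcoordZl vuncoordD vuncoordZ vK wK.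
- have t3 := tcode_lt t.
  rewrite vcoord_vket rep1 mul1mx vuncoord_unit; last exact: leq_trans t3 _.
  exact: basis_ket.
rewrite vcoordZ rep_x -[in RHS]vK.
rewrite [vcoord v]col_unit_vec.
have usum := big_morph vuncoord vuncoordD u0.
rewrite mulmx_sumr !usum scaler_sumr; apply: eq_bigr => j _.
transitivity ((vcoord v j 0)%:A *: (Dx k t *: basis j)); last first.
  by rewrite vuncoordZ (vuncoord_unit (ltn_ord j)); exact: esym (scale_algC _ _ _).
rewrite -scalemxAr vuncoordZ rep_mx_unit; congr (_ *: _).
rewrite -[t in RHS]transpsK (x_basis (tcode_lt t) (ltn_ord j)) /vec usum.
rewrite [LHS]big_seq [RHS]big_seq; apply: eq_bigr => p p_in.
rewrite vuncoordZ vuncoord_unit; last first.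
  have t_iota := tcode_iota t.
  have j_iota : (j : nat) \in iota 0 36 by rewrite mem_iota ltn_ord.
  by have /allP/(_ _ p_in) := all_mem (all_mem check_x_bound t_iota) j_iota.
exact: scale_alg_int.
Qed.

Lemma vcoord_inj : injective (@vcoord k).
Proof. exact: can_inj vcoordK. Qed.

End CoordinateInverse.

(** * The socle *)

Section Socle.
Variable k : fieldType.
Implicit Types (N : set (verma k)) (v : verma k).

(** The default 0 agrees with the zero matrix [rep_mx u] for [u >= 18], so [rep_gen_elt] holds for
    every code. *)
Definition gen_elt (u : nat) : Dfk k :=
  nth 0 ([seq Dx k t | t <- transps] ++ [seq Dy k t | t <- transps] ++
         [seq Dg k s | s <- S3_elements] ++ [seq Ddelta k s | s <- S3_elements]) u.

Definition spol_elt (p : spol) : Dfk k :=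
  \sum_(q <- p) (q.1%:~R : k) *: \prod_(u <- q.2) gen_elt u.

Lemma rep_gen_elt u : rep (gen_elt u) = rep_mx k u.
Proof.
have t12E : tcode_of t12 = 0%N by rewrite /tcode_of code_t12.
have t23E : tcode_of t23 = 1%N by rewrite /tcode_of code_t23.
have t13E : tcode_of t13 = 2%N by rewrite /tcode_of code_t13.
rewrite /gen_elt; do 3?[case: u => [|u]; first by rewrite /= rep_x ?t12E ?t23E ?t13E].
do 3?[case: u => [|u]; first by rewrite /= rep_y ?t12E ?t23E ?t13E].
have cE := code_S3_elements.
do 6?[case: u => [|u]; first by rewrite /= rep_g (cE 0, cE 1, cE 2, cE 3, cE 4, cE 5)%N].
do 6?[case: u => [|u]; first by rewrite /= rep_d (cE 0, cE 1, cE 2, cE 3, cE 4, cE 5)%N].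
rewrite nth_default // rep0; apply/matrixP=> i j; rewrite !mxE.
by rewrite /gen_act nth_default /= ?nth_nil /vec ?big_nil ?mxE.
Qed.

Lemma rep_spol_elt p : rep (spol_elt p) = spol_mx k p.
Proof.
rewrite /spol_elt (big_morph _ (@repD k) (rep0 k)); apply: eq_bigr => q _.
rewrite repZ (big_morph _ (@repM k) (rep1 k)); congr (_ *: _).
by apply: eq_bigr => u _; exact: rep_gen_elt.
Qed.

Lemma vcoord0 : vcoord (0 : verma k) = 0.
Proof. by rewrite -[0 in LHS](scale0r (0 : verma k)) vcoordZ rep0 mul0mx. Qed.

Lemma vcoord_spol_elt p u v : vcoord v = vec k u -> vcoord (spol_elt p *: v) = vec k (spol_act p u).
Proof. by move=> vu; rewrite vcoordZ rep_spol_elt vu spol_mx_vec. Qed.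

Definition top : verma k :=
  word_scale (fun l => Dx k (nth t12 transps l)) [:: 0; 1; 0; 2]%N (vket 1 t12).

Lemma vcoord_word w t : all (fun l => l < 3)%N w ->
  vcoord (word_scale (fun l => Dx k (nth t12 transps l)) w (vket 1 t)) =
  vec k (word_act w [:: (tcode_of t, 1)]).
Proof.
elim: w => [_|l w IHw /andP[l3 w3]].
  by rewrite vcoord_vket rep1 mul1mx -vec_unit.
rewrite [LHS]vcoordZ IHw // rep_x.
have -> : tcode_of (nth t12 transps l) = l.
  by case: l l3 => [|[|[|//]]] _; rewrite /tcode_of ?code_t12 ?code_t23 ?code_t13.
exact: rep_mx_vec.
Qed.

Lemma vcoord_top : vcoord top = vec k [:: (33%N, 1)].
Proof. by rewrite vcoord_word // /tcode_of code_t12 check_top. Qed.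

Opaque top spol_elt vcoord.

Lemma unit_vec_neq0 i : (i < 36)%N -> unit_vec k i != 0.
Proof.
move=> i36; apply/eqP=> /colP/(_ (Ordinal i36)); rewrite !mxE eqxx.
by apply/eqP; rewrite oner_eq0.
Qed.

Lemma top_neq0 : top <> 0.
Proof.
move=> t0; have := vcoord_top; rewrite t0 vcoord0 vec_unit => /esym/eqP.
by apply/negP/unit_vec_neq0.
Qed.

Lemma submodule_top N : submodule setT N -> N <> [set 0] -> N top.
Proof.
move=> sN N_neq0; have [N0 _ NZ] := sN.
have [v Nv v_neq0] : exists2 v, N v & v <> 0.
  apply: contrapT => noV; apply: N_neq0; apply/seteqP; split=> v /=.
    by move=> Nv; apply: contrapT => v0; apply: noV; exists v.
  by move=> ->.
have [i0 i0_neq0] : exists i, vcoord v i 0 != 0.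
  apply/existsP; rewrite -negb_forall; apply/negP=> /forallP v0; apply: v_neq0.
  apply: vcoord_inj; rewrite vcoord0; apply/colP=> i; rewrite mxE.
  exact/eqP/v0.
(* Coordinates before [i] vanish by minimality, and [detector i] kills the basis vectors after [i];
   only the term of index [i] survives. *)
have [i i_neq0 i_min] := @arg_minnP _ i0 (fun i => vcoord v i 0 != 0) (@nat_of_ord 36) i0_neq0.
have det_unit (j : 'I_36) : (i <= j)%N ->
    spol_act (detector i) [:: (val j, 1)] = if val i == val j then [:: (33%N, 1)] else [::].
  move=> ij; apply/eqP; apply: (all_mem (all_mem check_detector _)); rewrite mem_iota ?ltn_ord //.
  by rewrite ij subnKC ?ltn_ord // ltnW ?ltn_ord.
have detE : vcoord (spol_elt (detector i) *: v) = vcoord v i 0 *: vcoord top.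
  apply: etrans (vcoordZ _ _) _.
  rewrite rep_spol_elt spol_mx_col.
  rewrite (bigD1 i) //= big1 => [|j ji].
    by rewrite addr0 det_unit // eqxx vcoord_top.
  have [->|vj] := eqVneq (vcoord v j 0) 0; first by rewrite scale0r.
  by rewrite det_unit ?i_min // val_eqE eq_sym (negPf ji) /vec big_nil scaler0.
have -> : top = (vcoord v i 0)^-1%:A *: (spol_elt (detector i) *: v).
  apply: vcoord_inj; apply: esym; apply: etrans (vcoordZl _ _) _.
  apply: etrans (congr1 _ detE) _.
  by rewrite scalerA mulVf // scale1r.
by apply: (NZ) => //; apply: NZ.
Qed.

Definition topspan : set (verma k) := submod_span [set top].

Lemma topspan_submodule : submodule setT topspan.
Proof. exact: submod_span_submodule. Qed.

Lemma topspan_min N : submodule setT N -> N <> [set 0] -> topspan `<=` N.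
Proof.
move=> sN N0; apply: submod_span_min => // _ ->; exact: submodule_top.
Qed.

Lemma topspan_top : topspan top.
Proof. exact: sub_submod_span. Qed.

Lemma topspan_simple : simple_submodule topspan.
Proof.
split=> [||N sN NS]; first exact: topspan_submodule.
  by move=> S0; apply: top_neq0; have := topspan_top; rewrite S0.
have [->|N0] := pselect (N = [set 0]); [by left|right].
by apply/seteqP; split=> //; exact: topspan_min.
Qed.

Lemma socleE : socle (verma k) = topspan.
Proof.
apply/seteqP; split; last first.
  by apply: submod_span_min => [|_ ->]; [exact: submod_span_submodule|
    apply: sub_submod_span; exists topspan; [exact: topspan_simple|exact: topspan_top]].
apply: submod_span_min; first exact: topspan_submodule.
move=> v [N [sN N0 Nmin] Nv]; have SN := topspan_min sN N0.
have [S0|-> //] := Nmin _ topspan_submodule SN.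
by case: top_neq0; have := topspan_top; rewrite S0.
Qed.

End Socle.

Opaque Dx Dy Dg Ddelta top spol_elt vcoord basis ket_e1 ket_e3.

(** * The degrees occurring in the socle *)

Section SocleDegree.
Variable k : fieldType.

Definition socle_span : set 'cV[k]_36 :=
  submod_span [set w | exists2 s, s \in socle_basis & w = vec k s.2].

Lemma socle_span_vec v : v = socle_proj v -> socle_span (vec k v).
Proof.
have [K0 KD KZ] : submodule setT socle_span := submod_span_submodule _.
move=> ->; rewrite /socle_proj.
(* The induction varies the list folded by [socle_proj] while the span keeps the full basis; this
   inclusion records that the entries remain in it. *)
have : {subset socle_basis <= socle_basis} by [].
elim: {1 3}socle_basis => [|s r IHr] sub /=; first by rewrite /vec big_nil.
have Kr : socle_span (vec k (foldr (fun s => let a := scoef s.1 v in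
    if a == 0 then id else sadd (sscale a s.2)) [::] r)).
  by apply: IHr => s' s'r; apply: sub; rewrite inE s'r orbT.
case: eqP => // _; rewrite vec_add vec_scale; apply: KD => //; apply: KZ => //.
by apply: sub_submod_span; exists s; rewrite // sub ?inE ?eqxx.
Qed.

Lemma socle_span_rep_mx u w : (u < 18)%N -> socle_span w -> socle_span (rep_mx k u *m w).
Proof.
move=> u18; have [K0 KD KZ] : submodule setT socle_span := submod_span_submodule _.
apply: (@submod_span_min _ _ _ [set w | socle_span (rep_mx k u *m w)]) => /=.
  split=> /= [|v v' Kv Kv'|c v _ Kv]; rewrite ?mulmx0 ?mulmxDr -?scalemxAr //.
  - exact: KD.
  - exact: KZ.
move=> _ [s s_in ->] /=; rewrite rep_mx_vec; apply: socle_span_vec.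
apply/eqP; have u_in : u \in iota 0 18 by rewrite mem_iota.
by have /allP/(_ _ s_in) := all_mem check_socle_stable u_in.
Qed.

Lemma socle_span_rep (d : Dfk k) w : socle_span w -> socle_span (rep d *m w).
Proof.
have [K0 KD KZ] : submodule setT socle_span := submod_span_submodule _.
move: d w; apply: Dfk_ind => [w|c a b IHa IHb w Kw|a b IHa IHb w Kw|t w|t w|s w|h w].
- by rewrite rep1 mul1mx.
- rewrite repD repZ mulmxDl -scalemxAl.
  by apply: KD; [apply: KZ => //; exact: IHa|exact: IHb].
- by rewrite repM -mulmxA; apply: IHa; exact: IHb.
- by rewrite rep_x; apply: socle_span_rep_mx; rewrite (leq_trans (tcode_lt t)).
- rewrite rep_y; apply: socle_span_rep_mx.
  by rewrite (leq_ltn_trans _ (_ : 3 + 3 < 18)%N) // leq_add2l ltnW ?tcode_lt.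
- rewrite rep_g; apply: socle_span_rep_mx.
  by rewrite (leq_trans _ (_ : 6 + 6 <= 18)%N) // ltn_add2l code_lt.
- rewrite rep_d; apply: socle_span_rep_mx.
  by rewrite (leq_trans _ (_ : 12 + 6 <= 18)%N) // ltn_add2l code_lt.
Qed.

(** An upper bound on the socle; this inclusion is what [socle_delta] draws on, as delta_e can then
    be tested on ten vectors. *)
Lemma socle_coord (v : verma k) : topspan v -> socle_span (vcoord v).
Proof.
have [K0 KD KZ] : submodule setT socle_span := submod_span_submodule _.
apply: (@submod_span_min _ _ _ [set v | socle_span (vcoord v)]) => [|_ ->] /=.
  split=> /= [|u w Ku Kw|d u _ Ku]; first by rewrite vcoord0.
  - by rewrite vcoordD; apply: KD.
  - by rewrite vcoordZ; apply: socle_span_rep.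
by rewrite vcoord_top; apply: socle_span_vec; apply/eqP; vm_compute.
Qed.

Lemma socle_delta (v : verma k) : topspan v -> Ddelta k 1%g *: v = 0.
Proof.
move=> /socle_coord Kv; apply: vcoord_inj; rewrite vcoord0.
apply: etrans (vcoordZ _ _) _; rewrite rep_d code1; move: Kv.
apply: (@submod_span_min _ _ _ [set w | rep_mx k 12 *m w = 0]) => [|_ [s s_in ->]] /=.
  split=> /= [|u w u0 w0|c u _ u0]; rewrite ?mulmx0 ?mulmxDr ?u0 ?w0 ?addr0 //.
  by rewrite -scalemxAr u0 scaler0.
by rewrite rep_mx_vec (eqP (allP check_socle_degree _ s_in)) /vec big_nil.
Qed.

End SocleDegree.

Section TrivialLine.
Variable k : fieldType.

Let tc12 : tcode_of t12 = 0%N. Proof. by rewrite /tcode_of code_t12. Qed.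
Let tc23 : tcode_of t23 = 1%N. Proof. by rewrite /tcode_of code_t23. Qed.
Let tc13 : tcode_of t13 = 2%N. Proof. by rewrite /tcode_of code_t13. Qed.

Lemma vcoord_e1 : vcoord (ket_e1 k) = vec k e1_vec.
Proof.
rewrite check_e1 vec_add; apply: etrans (vcoordD _ _) _; congr (_ + _).
  rewrite vec_add; apply: etrans (vcoordD _ _) _; congr (_ + _).
all: apply: etrans (vcoord_vket _ _) _.
all: by rewrite rep_x ?tc12 ?tc23 ?tc13 -vec_unit rep_mx_vec.
Qed.

Lemma vcoordN (v : verma k) : vcoord (- v) = - vcoord v.
Proof.
apply: (addrI (vcoord v)); rewrite subrr; apply: etrans (esym (vcoordD _ _)) _.
by rewrite subrr vcoord0.
Qed.

Lemma vcoord_e3 : vcoord (ket_e3 k) = vec k e3_vec.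
Proof.
have word3 t1 t2 t3 t : vcoord (vket (Dx k t1 * Dx k t2 * Dx k t3) t) =
    vec k (word_act [:: tcode_of t1; tcode_of t2; tcode_of t3] [:: (tcode_of t, 1)]).
  apply: etrans (vcoord_vket _ _) _.
  rewrite repM repM !rep_x -word_mx_vec /word_mx !big_cons !big_nil mulr1 vec_unit.
  by rewrite [X in _ = X *m _]mulrA.
rewrite check_e3 vec_add; apply: etrans (vcoordD _ _) _; congr (_ + _).
  rewrite vec_add; apply: etrans (vcoordD _ _) _; congr (_ + _).
    by apply: etrans (word3 _ _ _ _) _; rewrite tc12 tc23 tc13.
  apply: etrans (vcoordN _) _; rewrite vec_scale mulrN1z scaleN1r; congr (- _).
  by apply: etrans (word3 _ _ _ _) _; rewrite tc12 tc23 tc13.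
by apply: etrans (word3 _ _ _ _) _; rewrite tc12 tc23 tc13.
Qed.

End TrivialLine.

(** * The submodules T *)

Section Generators.
Variable k : fieldType.

Let killed_vec (d : Dfk k) v (u : nat) s :
  rep d = rep_mx k u -> vcoord v = vec k s -> slin (gen_act u) s = [::] -> d *: v = 0.
Proof.
move=> du vs us; apply: vcoord_inj; apply: etrans (vcoordZ _ _) _.
by rewrite du vs rep_mx_vec us vcoord0 /vec big_nil.
Qed.

Let fixed_vec (d : Dfk k) v (u : nat) s :
  rep d = rep_mx k u -> vcoord v = vec k s -> slin (gen_act u) s = s -> d *: v = v.
Proof.
move=> du vs us; apply: vcoord_inj; apply: etrans (vcoordZ _ _) _.
by rewrite du vs rep_mx_vec us.
Qed.

Let topspan_vec (d : Dfk k) v (u : nat) s p :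
    rep d = rep_mx k u -> vcoord v = vec k s ->
    slin (gen_act u) s = spol_act p [:: (33%N, 1)] -> topspan (d *: v).
Proof.
move=> du vs us; have [_ _ SZ] := topspan_submodule k.
have -> : d *: v = spol_elt k p *: top k.
  apply: vcoord_inj; apply: etrans (vcoordZ _ _) _.
  apply: etrans (esym (vcoord_spol_elt p (vcoord_top k))).
  by rewrite du vs rep_mx_vec us.
by apply: SZ => //; exact: topspan_top.
Qed.

Lemma x_e1_topspan t : topspan (Dx k t *: ket_e1 k).
Proof.
have /and4P[/eqP E _ _ _] := all_mem check_x_e (tcode_iota t).
exact: topspan_vec (rep_x k t) (vcoord_e1 k) E.
Qed.

Lemma x_e3_topspan t : topspan (Dx k t *: ket_e3 k).
Proof.
have /and4P[_ /eqP E _ _] := all_mem check_x_e (tcode_iota t).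
exact: topspan_vec (rep_x k t) (vcoord_e3 k) E.
Qed.

Lemma y_e1 t : Dy k t *: ket_e1 k = 0.
Proof.
have /and4P[_ _ /eqP E _] := all_mem check_x_e (tcode_iota t).
exact: killed_vec (rep_y k t) (vcoord_e1 k) E.
Qed.

Lemma y_e3_topspan t : topspan (Dy k t *: ket_e3 k).
Proof.
have /and4P[_ _ _ /eqP E] := all_mem check_x_e (tcode_iota t).
exact: topspan_vec (rep_y k t) (vcoord_e3 k) E.
Qed.

Lemma g_e1 s : Dg k s *: ket_e1 k = ket_e1 k.
Proof.
have /andP[/eqP E _] := all_mem check_g_e (code_iota s).
exact: fixed_vec (rep_g k s) (vcoord_e1 k) E.
Qed.

Lemma g_e3 s : Dg k s *: ket_e3 k = ket_e3 k.
Proof.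
have /andP[_ /eqP E] := all_mem check_g_e (code_iota s).
exact: fixed_vec (rep_g k s) (vcoord_e3 k) E.
Qed.

Let code_eq0 (h : 'S_3) : (code h == 0%N) = (h == 1%g).
Proof. by rewrite -(inj_eq code_inj) code1. Qed.

Lemma d_e1 h : Ddelta k h *: ket_e1 k = if h == 1%g then ket_e1 k else 0.
Proof.
have /andP[/eqP E _] := all_mem check_d_e (code_iota h); move: E; rewrite code_eq0.
case: eqP => _ E; first exact: fixed_vec (rep_d k h) (vcoord_e1 k) E.
exact: killed_vec (rep_d k h) (vcoord_e1 k) E.
Qed.

Lemma d_e3 h : Ddelta k h *: ket_e3 k = if h == 1%g then ket_e3 k else 0.
Proof.
have /andP[_ /eqP E] := all_mem check_d_e (code_iota h); move: E; rewrite code_eq0.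
case: eqP => _ E; first exact: fixed_vec (rep_d k h) (vcoord_e3 k) E.
exact: killed_vec (rep_d k h) (vcoord_e3 k) E.
Qed.

End Generators.

Section TrivialLines.
Variables (k : fieldType) (lambda mu : k).
Hypothesis lm_neq0 : (lambda, mu) != (0, 0).

Definition e_vector : verma k := lambda%:A *: ket_e1 k + mu%:A *: ket_e3 k.

Lemma e_vectorZ (d : Dfk k) :
  d *: e_vector = lambda%:A *: (d *: ket_e1 k) + mu%:A *: (d *: ket_e3 k).
Proof. exact: scale_alg_comb. Qed.

Lemma e_vector_neq0 : e_vector <> 0.
Proof.
move=> e0; have E : lambda *: vec k e1_vec + mu *: vec k e3_vec = 0.
  rewrite -vcoord_e1 -vcoord_e3 -vcoord0 -e0; apply: esym; apply: etrans (vcoordD _ _) _.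
  by congr (_ + _); exact: vcoordZl.
move: lm_neq0; apply/negP; rewrite negbK.
(* Index 3 occurs only in [e1_vec] and index 28 only in [e3_vec], both with coefficient 1: these two
   coordinates are lambda and mu. *)
have /colP/(_ (Ordinal (isT : 3 < 36)%N)) := E.
have /colP/(_ (Ordinal (isT : 28 < 36)%N)) := E.
rewrite /vec !big_cons !big_nil !mxE /=.
rewrite ?(mulr0n, mulr1n, mulr1z, mulr0, mulr1, addr0, add0r) => -> ->.
by [].
Qed.

Lemma g_e_vector s : Dg k s *: e_vector = e_vector.
Proof. by rewrite e_vectorZ g_e1 g_e3. Qed.

Lemma d_e_vector h : Ddelta k h *: e_vector = if h == 1%g then e_vector else 0.
Proof.
apply: etrans (e_vectorZ _) _.
apply: etrans (congr2 (fun u w => lambda%:A *: u + mu%:A *: w) (d_e1 k h) (d_e3 k h)) _.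
case: eqP => _; first reflexivity.
exact: scale_alg_comb0.
Qed.

Lemma topspan_lin2 v w : topspan v -> topspan w -> topspan (lambda%:A *: v + mu%:A *: w).
Proof.
have [_ SD SZ] := topspan_submodule k.
by move=> Sv Sw; apply: SD; apply: SZ.
Qed.

Lemma x_e_vector t : topspan (Dx k t *: e_vector).
Proof. by rewrite e_vectorZ; apply: topspan_lin2; [exact: x_e1_topspan|exact: x_e3_topspan]. Qed.

Lemma y_e_vector t : topspan (Dy k t *: e_vector).
Proof.
have [S0 _ _] := topspan_submodule k.
by rewrite e_vectorZ; apply: topspan_lin2; [rewrite y_e1|exact: y_e3_topspan].
Qed.

Lemma tline_e_vector : tline lambda mu e_vector.
Proof. by exists 1 => //; rewrite !scale1r. Qed.

Lemma Tsub_submodule : submodule setT (Tsub lambda mu).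
Proof.
rewrite /Tsub socleE; have [S0 SD SZ] := topspan_submodule k.
pose T : set (verma k) := sumset (tline lambda mu) (@topspan k).
have T_intro (c : k) s : topspan s -> T (c%:A *: e_vector + s).
  by move=> Ss; exists (c%:A *: e_vector); [exists c | exists s].
have T_elim (P : set (verma k)) :
    (forall (c : k) s, topspan s -> P (c%:A *: e_vector + s)) -> forall v, T v -> P v.
  by move=> TP _ [_ [c _ <-] [s Ss <-]]; exact: TP.
have TD v w : T v -> T w -> T (v + w).
  move: v; apply: (T_elim) => c s Ss; move: w; apply: (T_elim) => c' s' Ss'.
  by rewrite -scale_alg_addrACA; apply: T_intro; exact: SD.
have TZ (c : k) v : T v -> T (c%:A *: v).
  move: v; apply: (T_elim) => c' s Ss; rewrite scale_alg_combM.
  by apply: T_intro; exact: SZ.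
have ST v : topspan v -> T v.
  by move=> Sv; rewrite -(scale_alg0 e_vector v); exact: T_intro.
have eT : T e_vector by rewrite -(scale_alg1 e_vector); exact: T_intro.
(* The socle is already stable, so each generator has to be tested on [e_vector] only. *)
have T_gen (d : Dfk k) : T (d *: e_vector) -> forall v, T v -> T (d *: v).
  move=> Tde; apply: (T_elim) => c s Ss; rewrite scale_alg_combr.
  by apply: (TD); [exact: TZ|apply: ST; exact: SZ].
split=> [|//|d v _]; first exact: ST.
move: d v; apply: Dfk_ind => [v|c a b IHa IHb v Tv|a b IHa IHb v Tv|t|t|s|h].
- by rewrite scale1r.
- rewrite scale_alg_lin; apply: (TD); [apply: TZ; exact: IHa|exact: IHb].
- by rewrite -scalerA; apply: IHa; exact: IHb.
- by apply: (T_gen); apply: ST; exact: x_e_vector.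
- by apply: (T_gen); apply: ST; exact: y_e_vector.
- by apply: (T_gen); rewrite g_e_vector.
- by apply: (T_gen); rewrite d_e_vector; case: eqP => _; last exact: ST.
Qed.

(** The generated submodule is nonzero, hence contains the socle by [topspan_min]; no element of the
    double carrying [e_vector] to [top] has to be exhibited. *)
Lemma submod_span_tline : submod_span (tline lambda mu) = Tsub lambda mu.
Proof.
have [T0 TD TZ] := Tsub_submodule; have [S0 SD SZ] := topspan_submodule k.
apply/seteqP; split.
  apply: submod_span_min; first exact: Tsub_submodule.
  move=> v tv; exists v => //; exists 0; last exact: addr0.
  by rewrite socleE.
have sN := submod_span_submodule (tline lambda mu); have [N0 ND NZ] := sN.
move=> _ [v tv [s Ss <-]]; apply: ND; first exact: sub_submod_span.
move: s Ss; rewrite socleE; apply: topspan_min => // N_eq0.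
have := sub_submod_span tline_e_vector; rewrite N_eq0; exact: e_vector_neq0.
Qed.

(** Makes the sum defining [Tsub] direct. *)
Lemma tline_socle : tline lambda mu `&` socle (verma k) = [set 0].
Proof.
have [S0 _ _] := topspan_submodule k.
rewrite socleE; apply/seteqP; split=> [_ [[c _ <-] /socle_delta]|_ ->] /=; last first.
  by split=> //; exists 0 => //; rewrite !scale0r.
by rewrite -/e_vector scale_algC d_e_vector eqxx.
Qed.

End TrivialLines.

(** * The highest-weight structure of T_(1,0) *)

Section HighestWeight.
Variable k : fieldType.
Local Notation e := (e_vector (1 : k) 0).

Let lm_neq0 : ((1 : k), (0 : k)) != (0, 0).
Proof. by apply/eqP=> -[/eqP]; rewrite oner_eq0. Qed.

(** Here mu = 0 enters: the y's kill |e>^1, while [y_e3_topspan] only places the image of |e>^3 in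
    the socle. *)
Let y_e t : Dy k t *: e = 0.
Proof.
apply: etrans (e_vectorZ _ _ _) _.
apply: etrans (congr1 (fun u => _%:A *: u + _) (y_e1 k t)) _.
exact: scale_alg10.
Qed.

Lemma Me_act_graph a f (w : k^o) :
  act_graph (@Me_gen k) a f -> (f w : k)%:A *: e = a *: ((w : k)%:A *: e).
Proof.
move=> af; move: w; elim: af => {a f}[a f|w|c a f b g _ IHf _ IHg w|a f b g _ IHf _ IHg w].
- case=> {a f}[s|h] w; rewrite scale_algC; first by rewrite g_e_vector.
  rewrite d_e_vector; case: eqP => _ /=.
    by rewrite scale1r.
  by rewrite !scale0r scaler0.
- by rewrite scale1r.
- rewrite scale_alg_lin -IHf -IHg; exact: scale_alg_linl.
- apply: etrans (IHf _) _; apply: etrans (congr1 ( *:%R a) (IHg _)) _; exact: scalerA.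
Qed.

Lemma highest_weight_T10 : highest_weight (@Me_gen k) (Tsub (1 : k) 0).
Proof.
have TE := submod_span_tline lm_neq0; split; first exact: Tsub_submodule.
exists (tline 1 0); split; last exact: TE.
- split=> [|v w [c _ <-] [c' _ <-]|a v aD [c _ <-]].
  + by exists 0 => //; rewrite !scale0r.
  + by exists (c + c') => //; exact: scale_algD.
  have [f af] : exists f, act_graph (@Me_gen k) a f by apply/Me_domain.
  exists (f c : k); first by [].
  exact: (Me_act_graph c af).
- exists (fun w : k^o => (w : k)%:A *: e); split; [| |reflexivity|].
  + by move=> c w w'; exact: scale_alg_linl.
  + move=> a b /= ab; apply: contrapT => a_neq_b.
    apply: (e_vector_neq0 lm_neq0); apply: (@scale_alg_eq0 k _ _ ((a : k) - (b : k))).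
      by rewrite subr_eq0; apply/eqP.
    apply: etrans (scale_algB _ _ _) _; apply: etrans (congr1 (fun u => u - _) ab) _.
    exact: subrr.
  + by move=> a f w /Me_act_graph.
- move=> _ _ [c _ <-] [c' _ <-]; rewrite scaler_suml big1 // => t _.
  exact: scale_alg_kill (y_e t).
Qed.

End HighestWeight.

Theorem lemma26 (k : closedFieldType) (char0 : [pchar k] =i pred0) :
  (forall lambda mu : k, (lambda, mu) != (0, 0) ->
     tline lambda mu `&` socle (verma k) = [set 0] /\
     submod_span (tline lambda mu) = Tsub lambda mu) /\
  highest_weight (@Me_gen k) (Tsub (1 : k) (0 : k)).
Proof.
split; last exact: highest_weight_T10.
by move=> lambda mu lm; split; [exact: tline_socle | exact: submod_span_tline].
Qed.
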